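(* Let $e=(e(t))_{0\le t\le 1}$ be the normalized Brownian excursion, let $\mathcal J$ be the one-dimensional integrated superBrownian excursion (ISE), let $S=\int_{\mathbb R} x\,\mathcal J(dx)$ be its center of mass, and let $$\eta=4\int_{0\le s<t\le 1}\min_{s\le u\le t}e(u)\,ds\,dt .$$ Let $N$ be a standard Gaussian random variable independent of $\eta$. Then $S$ and $\sqrt{\eta}\,N$ have the same distribution.
   Context: Brownian snake with lifetime $\zeta$. Let $\zeta=2e$ on $[0,1]$, where $e$ is the normalized Brownian excursion (equivalently, the 3-dimensional Bessel bridge from $0$ to $0$ on $[0,1]$), and for $s\le t$ let $C(s,t)=\min_{s\le u\le t}\zeta(u)$. The (one-dimensional) Brownian snake $W=(W_s(t))_{0\le s\le 1,\,0\le t\le \zeta(s)}$ with lifetime $\zeta$ is the process such that: (a) for every $s\in[0,1]$, conditionally given $\zeta$, $t\mapsto W_s(t)$, $0\le t\le\zeta(s)$, is a standard linear Brownian motion started at $0$; (b) conditionally given $\zeta$, $s\mapsto W_s(\cdot)$ is a path-valued Markov process with the following transition mechanism: for $s_1<s_2$ and $m=C(s_1,s_2)$, one has $W_{s_2}(t)=W_{s_1}(t)$ for $0\le t\le m$, and conditionally given $W_{s_1}(\cdot)$, the process $(W_{s_2}(m+t))_{0\le t\le \zeta(s_2)-m}$ is a standard Brownian motion started from $W_{s_1}(m)$ (whose increments are independent of $W_{s_1}(\cdot)$). Put $\widehat W_s=W_s(\zeta(s))$ for $0\le s\le1$ (as usual, a version with continuous paths $s\mapsto\widehat W_s$ is taken).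 The ISE $\mathcal J$ is the random probability measure on $\mathbb R$ that is the occupation measure of $\widehat W$: $\int_{\mathbb R} f(x)\,\mathcal J(dx)=\int_0^1 f(\widehat W_s)\,ds$ for measurable test functions $f$. In particular $S=\int_0^1\widehat W_s\,ds$. *)

(* Defs.v *)
From HB Require Import structures.
From mathcomp Require Import all_boot all_order all_algebra.
From mathcomp Require Import all_classical all_reals all_analysis.

Set Implicit Arguments.
Unset Strict Implicit.
Unset Printing Implicit Defensive.

Import Order.TTheory GRing.Theory Num.Theory.
Import numFieldNormedType.Exports.

Local Open Scope classical_set_scope.
Local Open Scope ring_scope.

(* Real-valued processes are curried with the index first: [X t w] is the value
   at time [t] of the path attached to [w]. Times are real numbers, and only
   the values of a process on its natural time interval matter. *)

Section Processes.
Context {R : realType} {d : measure_display} {T : measurableType d}.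
Implicit Types (X : R -> T -> R).

(* For continuous paths this infimum is a minimum. *)
Definition path_min X (s t : R) (w : T) : R := inf [set X u w | u in `[s, t]].

(* The events [X i \in B], for i in D and B a Borel set. *)
Definition process_events (D : set R) X : set (set T) :=
  \bigcup_(i in D) preimage_set_system setT (X i) measurable.

(* Equality in law is only required on Borel sets, where both sides make
   sense; that the two functions are random variables is part of it. *)
Definition same_distribution (P : probability T R) (X Y : T -> R) : Prop :=
  [/\ measurable_fun setT X, measurable_fun setT Y &
      forall A : set R, measurable A -> P (X @^-1` A) = P (Y @^-1` A)].

Definition independent_pair (P : probability T R) (X Y : T -> R) : Prop :=
  forall A B : set R, measurable A -> measurable B ->
    P (X @^-1` A `&` Y @^-1` B) = (P (X @^-1` A) * P (Y @^-1` B))%E.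

Definition standard_gaussian (P : probability T R) (X : T -> R) : Prop :=
  forall A : set R, measurable A -> P (X @^-1` A) = normal_prob 0 1 A.

End Processes.

Section Excursion.
Context {R : realType}.

(* Transition density of linear Brownian motion killed when it hits 0. *)
Definition killed_density (t x y : R) : R :=
  normal_pdf 0 (Num.sqrt t) (y - x) - normal_pdf 0 (Num.sqrt t) (y + x).

(* Density at time t of the hitting time of 0 by a linear Brownian motion
   started from x, namely x / sqrt (2 pi t^3) * exp (- x^2 / (2 t)). *)
Definition hitting_density (t x : R) : R :=
  x / t * normal_pdf 0 (Num.sqrt t) x.

(* With p the killed density and q the hitting density, the iterated integral
     int_{A_(i+1)} p(t_(i+1) - t_i, x, x_(i+1)) ... int_{A_(i+k)}
       p(t_(i+k) - t_(i+k-1), x_(i+k-1), x_(i+k)) q(1 - t_(i+k), x_(i+k)). *)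
Fixpoint excursion_tail (t : nat -> R) (A : nat -> set R) (k i : nat) (x : R)
    : \bar R :=
  match k with
  | 0%N => (hitting_density (1 - t i) x)%:E
  | k'.+1 => (\int[lebesgue_measure]_(y in A i.+1 `&` `[0%R, +oo[)
      ((killed_density (t i.+1 - t i) x y)%:E * excursion_tail t A k' i.+1 y))%E
  end.

(* P(e(t_0) \in A_0, ..., e(t_n) \in A_n) for 0 < t_0 < ... < t_n < 1: the
   finite-dimensional density of the normalized Brownian excursion is
     2 sqrt(2 pi) q(t_0, x_0) p(t_1 - t_0, x_0, x_1) ... q(1 - t_n, x_n)
   on positive (x_0, ..., x_n). *)
Definition excursion_fdd (t : nat -> R) (A : nat -> set R) (n : nat) : \bar R :=
  (\int[lebesgue_measure]_(x in A 0%N `&` `[0%R, +oo[)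
     ((2 * Num.sqrt (2 * pi) * hitting_density (t 0%N) x)%R%:E
      * excursion_tail t A n 0 x))%E.

Record brownian_excursion (d : measure_display) (T : measurableType d)
    (P : probability T R) (e : R -> T -> R) : Prop := BrownianExcursion {
  excursion_measurable : forall t, 0 <= t <= 1 -> measurable_fun setT (e t);
  excursion_continuous : forall w, {within `[0, 1], continuous (e ^~ w)};
  excursion_ge0 : forall t w, 0 <= t <= 1 -> 0 <= e t w;
  excursion_start : forall w, e 0 w = 0;
  excursion_end : forall w, e 1 w = 0;
  excursion_law : forall (n : nat) (t : nat -> R) (A : nat -> set R),
    0 < t 0%N -> (forall i, (i < n)%N -> t i < t i.+1) -> t n < 1 ->
    (forall i, measurable (A i)) ->
    P [set w | forall i, (i <= n)%N -> A i (e (t i) w)]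
    = excursion_fdd t A n }.

End Excursion.

Section Snake.
Context {R : realType} {d : measure_display} {T : measurableType d}.
Variable P : probability T R.
Implicit Types (zeta : R -> T -> R) (W : R -> R -> T -> R).

(* Conditionally given the sigma-algebra G, (B_t)_{0 <= t <= L} is a Brownian
   motion started from X, where L and X are G-measurable. The last clause says
   that, on {t_n <= L}, the conditional law given G of the increments of B
   along t_0 < ... < t_n is a product of centered Gaussian laws with variances
   t_(i+1) - t_i, free of w; [normal_prob] takes a standard deviation. *)
Definition conditional_brownian_motion (G : set (set T)) (L X : T -> R)
    (B : R -> T -> R) : Prop :=
  [/\ {ae P, forall w, B 0 w = X w},
      forall w, {within `[0, L w], continuous (B ^~ w)} &
      forall (n : nat) (t : nat -> R) (A : nat -> set R) (E : set T),
        t 0%N = 0 -> (forall i, (i < n)%N -> t i < t i.+1) ->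
        (forall i, measurable (A i)) -> G E ->
        P (E `&` [set w | t n <= L w] `&`
           [set w | forall i, (i < n)%N -> A i (B (t i.+1) w - B (t i) w)])
        = (P (E `&` [set w | (t n <= L w)%R]) *
           \prod_(i < n) normal_prob 0%R (Num.sqrt (t i.+1 - t i)%R) (A i))%E].

(* The path W_s frozen at its terminal value after its lifetime zeta(s); it
   carries the same information as (W_s(t))_{0 <= t <= zeta(s)}. *)
Definition stopped_path zeta W (s t : R) (w : T) : R :=
  W s (Num.min t (zeta s w)) w.

Definition lifetime_sigma zeta : set (set T) :=
  <<s process_events `[0, 1] zeta >>.

(* sigma(zeta) joined with sigma(W_u : 0 <= u <= s). *)
Definition snake_past zeta W (s : R) : set (set T) :=
  <<s process_events `[0, 1] zeta `|`
      \bigcup_(u in `[0, s]) process_events `[0, +oo[ (stopped_path zeta W u) >>.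

Definition snake_head zeta W (s : R) (w : T) : R := W s (zeta s w) w.

(* [W s t w] is meaningful for 0 <= s <= 1 and 0 <= t <= zeta s w.
   [snake_glue] and [snake_branch] together are the Markov property given zeta
   with the stated transition mechanism: conditioning is on zeta and the whole
   past (W_u)_{u <= s1}, while the conditional law of W_s2 depends only on zeta
   and W_s1. *)
Record brownian_snake zeta W : Prop := BrownianSnake {
  snake_measurable : forall s t, 0 <= s <= 1 -> 0 <= t ->
    measurable_fun setT (stopped_path zeta W s t);
  snake_path : forall s, 0 <= s <= 1 ->
    conditional_brownian_motion (lifetime_sigma zeta) (zeta s) (cst 0) (W s);
  snake_glue : forall s1 s2, 0 <= s1 -> s1 < s2 -> s2 <= 1 ->
    {ae P, forall w, forall t, 0 <= t -> t <= path_min zeta s1 s2 w ->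
       W s2 t w = W s1 t w};
  snake_branch : forall s1 s2, 0 <= s1 -> s1 < s2 -> s2 <= 1 ->
    let m := path_min zeta s1 s2 in
    conditional_brownian_motion (snake_past zeta W s1)
      (fun w => zeta s2 w - m w) (fun w => W s1 (m w) w)
      (fun t w => W s2 (m w + t) w);
  snake_head_continuous : forall w,
    {within `[0, 1], continuous (fun s => snake_head zeta W s w)} }.

(* J is the integrated superBrownian excursion of the snake W: the random
   occupation measure of the head of W. *)
Definition is_ISE zeta W (J : T -> probability R R) : Prop :=
  forall (w : T) (f : R -> R),
    measurable_fun setT f -> (forall x, 0 <= f x) ->
    (\int[J w]_x (f x)%:E =
     \int[lebesgue_measure]_(s in `[0%R, 1%R]) (f (snake_head zeta W s w))%:E)%E.

Definition center_of_mass (J : T -> probability R R) (w : T) : R :=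
  \int[J w]_x x.

Definition excursion_eta (e : R -> T -> R) (w : T) : R :=
  4 * \int[(lebesgue_measure \x lebesgue_measure)%E]_(p in
        [set p : R * R | [/\ 0 <= p.1, p.1 < p.2 & p.2 <= 1]])
        path_min e p.1 p.2 w.

End Snake.

(* Main.v *)
(** The center of mass is the time integral of the head of the snake, hence the
limit of the Riemann sums [n^-1 * sum_j head (j / n)]. Given [zeta], such a sum
is centered Gaussian: exploring the times [j / n] in increasing order, each new
path branches off the previous one at height [min zeta] and its new piece is a
Brownian motion independent of the past, so the sum is built from independent
Gaussian contributions, and the covariance of the heads at [s <= t] comes out as
[min_[s, t] zeta]. The conditional variance of the Riemann sum is thus a Riemann
sum of [int int min zeta], which converges to [eta] since [zeta = 2 e]. Letting
[n] tend to infinity in [E (f (S_n)) = E (f (sqrt eta_n * N))] for bounded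
continuous [f] gives the theorem. *)

Require Import Defs.
From HB Require Import structures.
From mathcomp Require Import all_boot all_order all_algebra.
From mathcomp Require Import all_classical all_reals all_analysis.
From mathcomp Require Import measurable_realfun ring lra.

Set Implicit Arguments.
Unset Strict Implicit.
Unset Printing Implicit Defensive.

Import Order.TTheory GRing.Theory Num.Theory.
Import numFieldNormedType.Exports.

Local Open Scope classical_set_scope.
Local Open Scope ring_scope.

(** * Gaussian laws *)

(** No regular conditional laws are constructed. A conditioning sigma-algebra enters as a measurable
    map [u], in the end the identity into [T] with a coarser sigma-algebra, and conditional
    normality is an identity of integrals of kernels in the pair of [u] and the variable, which
    survives pointwise limits. The obstacle is that the snake axioms describe increments only along
    deterministic heights, on events where these heights stay below the lifetime, whereas branching
    heights are random functions of the lifetime process. They are rounded down to a mesh. On each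
    event that fixes the number of mesh steps in the lifetime, the sum is a combination of i.i.d.
    Gaussian increments with coefficients known from [u]; then the mesh tends to 0. Each step of the
    exploration adds all that a new branch contributes, not only to the next head but also to every
    later head that still follows this branch. The conditional variance of such an increment given
    the whole past depends on the lifetime process alone, so variances simply add up and no joint
    law of the heads is needed. *)

Section ImageMeasure.
Context d1 d2 (T1 : measurableType d1) (T2 : measurableType d2) (R : realType).

(** Carrying the measurability proof as an argument lets the measure and finite-measure structures
    below be inferred from the term alone. *)
Definition image_measure (m : set T1 -> \bar R) (f : T1 -> T2)
  & measurable_fun setT f : set T2 -> \bar R := fun A => m (f @^-1` A).

Section ImageMeasureInstance.
Variables (m : {measure set T1 -> \bar R}) (f : T1 -> T2).
Hypothesis mf : measurable_fun setT f.

Let image_measure0 : image_measure m mf set0 = 0%E.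
Proof. by rewrite /image_measure preimage_set0 measure0. Qed.

Let image_measure_ge0 A : (0 <= image_measure m mf A)%E.
Proof. exact: measure_ge0. Qed.

Let image_measure_sigma_additive : semi_sigma_additive (image_measure m mf).
Proof.
move=> F mF tF mUF.
have mpre A : measurable A -> measurable (f @^-1` A).
  by move=> mA; rewrite -[X in measurable X]setTI; exact: mf.
rewrite /image_measure preimage_bigcup; apply: measure_semi_sigma_additive.
- by move=> n; exact: mpre.
- apply/trivIsetP => /= i j _ _ ij; rewrite -preimage_setI.
  by move/trivIsetP : tF => /(_ _ _ _ _ ij) ->//; rewrite preimage_set0.
- by rewrite -preimage_bigcup; exact: mpre.
Qed.

HB.instance Definition _ := isMeasure.Build _ _ _ (image_measure m mf)
  image_measure0 image_measure_ge0 image_measure_sigma_additive.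

Lemma ge0_integral_image_measure (g : T2 -> \bar R) :
  measurable_fun setT g -> (forall y, 0 <= g y)%E ->
  (\int[image_measure m mf]_y g y = \int[m]_x g (f x))%E.
Proof.
move=> mg g0; exact: (ge0_integral_pushforward mf m measurableT mg).
Qed.

End ImageMeasureInstance.

Section FiniteImageMeasure.
Variables (m : {finite_measure set T1 -> \bar R}) (f : T1 -> T2).
Hypothesis mf : measurable_fun setT f.

Let image_measure_fin : fin_num_fun (image_measure m mf).
Proof.
move=> A mA; apply: fin_num_measure.
by rewrite -[X in measurable X]setTI; exact: mf.
Qed.

HB.instance Definition _ := @Measure_isFinite.Build _ _ _ (image_measure m mf)
  image_measure_fin.

End FiniteImageMeasure.
End ImageMeasure.

Lemma ge0_integral_mrestr d (T : measurableType d) (R : realType)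
    (m : {measure set T -> \bar R}) (D : set T) (mD : measurable D)
    (f : T -> \bar R) : measurable_fun setT f -> (forall x, 0 <= f x)%E ->
  (\int[mrestr m mD]_x f x = \int[m]_(x in D) f x)%E.
Proof.
move=> mf f0.
rewrite (@ge0_negligible_integral _ _ _ (mrestr m mD) setT (~` D))//; last 2 first.
- exact: measurableC.
- by rewrite /= /mrestr setICl measure0.
rewrite setTD setCK; apply: eq_measure_integral => A mA AD.
by rewrite /= /mrestr (setIidl AD).
Qed.

(** The identity on rectangles says that the image of [Q] under the pair is a product measure, so
    Tonelli applies. [Q] is only assumed finite because it will be a probability restricted to an
    event. *)
Lemma integral_independent d d' d'' (T : measurableType d) (U : measurableType d')
    (V : measurableType d'')
    (R : realType) (Q : {finite_measure set T -> \bar R}) (g : probability V R)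
    (u : T -> U) (D : T -> V) (h : U * V -> \bar R) :
  measurable_fun setT u -> measurable_fun setT D ->
  (forall A B, measurable A -> measurable B ->
    Q (u @^-1` A `&` D @^-1` B) = Q (u @^-1` A) * g B)%E ->
  measurable_fun setT h -> (forall x, 0 <= h x)%E ->
  (\int[Q]_w h (u w, D w) = \int[Q]_w \int[g]_z h (u w, z))%E.
Proof.
move=> mu mD ind mh h0.
have muD : measurable_fun setT (fun w => (u w, D w)) by exact: measurable_fun_pair.
transitivity (\int[image_measure Q muD]_x h x)%E.
  by rewrite ge0_integral_image_measure.
transitivity (\int[image_measure Q mu \x g]_x h x)%E.
  apply: eq_measure_integral => A mA _.
  apply/esym/(@product_measure_unique _ _ _ _ _ (image_measure Q mu) g
    (image_measure Q muD)); [|exact: mA].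
  by move=> B C mB mC; exact: ind.
rewrite fubini_tonelli1// ge0_integral_image_measure//.
- exact: measurable_fun_fubini_tonelli_F.
- by move=> x; exact: integral_ge0.
Qed.

Lemma integral_probability_cst d (T : measurableType d) (R : realType)
  (P : probability T R) (r : \bar R) : (\int[P]_x r = r)%E.
Proof.
by rewrite -[RHS]mule1 -(probability_setT P); exact: integral_cst.
Qed.

Section Gaussian.
Context {R : realType}.
Local Notation mu := (@lebesgue_measure R).
Local Notation gamma := (normal_prob (0 : R) 1).

Lemma ge0_integral_normal_prob (m s : R) (f : R -> \bar R) :
  measurable_fun setT f -> (forall x, 0 <= f x)%E ->
  (\int[normal_prob m s]_x f x = \int[mu]_x (f x * (normal_pdf m s x)%:E))%E.
Proof.
move=> mf f0.
rewrite -(@Radon_Nikodym_SigmaFinite.change_of_variables _ _ _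
   (normal_prob m s) mu (normal_prob_dominates m s)) //.
have dom := normal_prob_dominates m s.
apply: ae_eq_integral => //.
- apply: emeasurable_funM => //; apply: (measurable_int mu).
  exact: Radon_Nikodym_SigmaFinite.f_integrable.
- apply: emeasurable_funM => //; apply/measurable_EFinP.
  exact: measurable_normal_pdf.
(* The Radon-Nikodym derivative and [normal_pdf] have the same integral over every measurable set,
   hence agree almost everywhere. *)
apply: ae_eqe_mul2l; apply: integral_ae_eq => //=.
- exact: Radon_Nikodym_SigmaFinite.f_integrable.
- by apply/measurable_EFinP; exact: measurable_normal_pdf.
by move=> E _ mE; rewrite -Radon_Nikodym_SigmaFinite.f_integral.
Qed.

Lemma lebesgue_measure_affine (m s : R) (A : set R) : 0 < s -> measurable A ->
  (s%:E * mu ((fun z : R => (m + s * z)%R) @^-1` A) = mu A)%E.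
Proof.
move=> s0 mA.
pose phi : measurableTypeR R -> measurableTypeR R := fun z => m + s * z.
have mphi : measurable_fun setT phi.
  by apply: measurable_funD => //; exact: measurable_funM.
pose nu := mscale (NngNum (ltW s0)) (image_measure mu mphi).
(* Lebesgue measure is determined by its values on half-open intervals. *)
suff H X : ocitv X -> mu X = nu X.
  by rewrite (lebesgue_measure_unique H mA).
move=> [[a b] _ <-].
rewrite /nu /mscale/= /image_measure/= /pushforward.
rewrite (_ : phi @^-1` _ = `](a - m) / s, (b - m) / s]%classic); last first.
  apply/seteqP; split => z /=; rewrite !in_itv/= /phi;
    by rewrite ltr_pdivrMr// ler_pdivlMr// ltrBlDl lerBrDl [z * s]mulrC.
rewrite [in LHS]lebesgue_measure_itv [X in (_ * X)%E]lebesgue_measure_itv/= !lte_fin.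
rewrite ltr_pM2r ?invr_gt0// ltrD2r.
case: ifPn => _; last by rewrite mule0.
by rewrite -EFinM; congr EFin; field; rewrite gt_eqF.
Qed.

Lemma ge0_integral_affine (m s : R) (f : R -> \bar R) : 0 < s ->
  measurable_fun setT f -> (forall x, 0 <= f x)%E ->
  (\int[mu]_x f x = s%:E * \int[mu]_z f (m + s * z)%R)%E.
Proof.
move=> s0 mf f0.
pose phi : measurableTypeR R -> measurableTypeR R := fun z => m + s * z.
have mphi : measurable_fun setT phi.
  by apply: measurable_funD => //; exact: measurable_funM.
pose nu := mscale (NngNum (ltW s0)) (image_measure mu mphi).
transitivity (\int[nu]_x f x)%E.
  by apply: eq_measure_integral => A mA _; exact: (esym (lebesgue_measure_affine m s0 mA)).
by rewrite ge0_integral_mscale//= ge0_integral_image_measure.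
Qed.

Lemma ge0_integral_normal_affine (m s : R) (f : R -> \bar R) : 0 < s ->
  measurable_fun setT f -> (forall x, 0 <= f x)%E ->
  (\int[normal_prob m s]_x f x = \int[gamma]_z f (m + s * z)%R)%E.
Proof.
move=> s0 mf f0.
have mphi : measurable_fun setT (fun z : R => m + s * z).
  by apply: measurable_funD => //; exact: measurable_funM.
have mnp m' s' : measurable_fun [set: R] (EFin \o normal_pdf m' s').
  by apply/measurable_EFinP; exact: measurable_normal_pdf.
have mfphi : measurable_fun [set: R] (fun z : R => f (m + s * z)).
  exact: measurableT_comp mf mphi.
rewrite (ge0_integral_normal_prob m s mf f0).
rewrite (ge0_integral_normal_prob 0 1 mfphi); last by move=> x; exact: f0.
rewrite (ge0_integral_affine m s0)//; last 2 first.
- by apply: emeasurable_funM => //; exact: mnp.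
- by move=> x; rewrite mule_ge0// lee_fin normal_pdf_ge0.
rewrite -ge0_integralZl//; last 3 first.
- apply: emeasurable_funM => //.
  by apply: (measurableT_comp (mnp m s)).
- by move=> x _; rewrite mule_ge0// lee_fin normal_pdf_ge0.
- by rewrite lee_fin ltW.
apply: eq_integral => z _; rewrite muleCA; congr (_ * _)%E.
rewrite -EFinM; congr EFin.
rewrite !normal_pdfE ?oner_neq0 ?gt_eqF// /normal_peak /normal_fun.
rewrite addrC addKr subr0 expr1n mul1r mulrA -mulrnAr sqrtrM ?sqr_ge0//.
rewrite sqrtr_sqr gtr0_norm// invfM mulrA divff ?gt_eqF// mul1r.
by congr (_ * expR _); field; rewrite gt_eqF.
Qed.

(* Completing the square, with [c^2 = a^2 + b^2]. *)
Lemma normal_pdf_convolution (a b c x y : R) : 0 < a -> 0 < b -> 0 < c ->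
  c ^+ 2 = a ^+ 2 + b ^+ 2 ->
  normal_pdf 0 a x * normal_pdf x b y =
  normal_pdf 0 c y * normal_pdf (a ^+ 2 / c ^+ 2 * y) (a * b / c) x.
Proof.
move=> a0 b0 c0 cE.
have s0 : 0 < a * b / c by rewrite divr_gt0// mulr_gt0.
rewrite !normal_pdfE ?gt_eqF// /normal_peak /normal_fun.
have pk s : 0 < s -> (Num.sqrt (s ^+ 2 * pi *+ 2))^-1 = s^-1 * (Num.sqrt (pi *+ 2))^-1 :> R.
  move=> s1; rewrite -mulrnAr sqrtrM ?sqr_ge0//.
  by rewrite sqrtr_sqr gtr0_norm// invfM.
rewrite !pk// mulrACA [RHS]mulrACA -!expRD; congr (_ * expR _).
  by set k := (Num.sqrt _)^-1; field; rewrite !gt_eqF.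
have e : c ^+ 2 != 0 by rewrite gt_eqF// exprn_gt0.
rewrite !subr0 !expr_div_n exprMn cE; field.
by rewrite -cE e !gt_eqF.
Qed.

(** For positive weights, rescaling turns the left side into the integral of [f y] against the joint
    density of a normal variable [x] and of [y] centered at [x]. After exchanging the integrals,
    [normal_pdf_convolution] isolates a density in [x], of total mass 1. *)
Lemma integral_gaussian_convolution (a b : R) (f : R -> \bar R) :
  measurable_fun setT f -> (forall x, 0 <= f x)%E -> 0 <= a -> 0 <= b ->
  (\int[gamma]_x \int[gamma]_y f (a * x + b * y)%R =
   \int[gamma]_z f (Num.sqrt (a ^+ 2 + b ^+ 2) * z)%R)%E.
Proof.
(* Zero weights are treated apart: the densities below need positive standard deviations. *)
move=> mf f0; rewrite le_eqVlt => /predU1P[<-|a0].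
  move=> b0; rewrite expr0n add0r sqrtr_sqr ger0_norm//.
  under eq_integral do under eq_integral do rewrite mul0r add0r.
  exact: (integral_probability_cst gamma).
rewrite le_eqVlt => /predU1P[<-|b0].
  rewrite expr0n addr0 sqrtr_sqr gtr0_norm//.
  apply: eq_integral => x _.
  under eq_integral do rewrite mul0r addr0.
  exact: (integral_probability_cst gamma).
set c := Num.sqrt _.
have cE : c ^+ 2 = a ^+ 2 + b ^+ 2 by rewrite sqr_sqrtr// addr_ge0// sqr_ge0.
have c0 : 0 < c by rewrite sqrtr_gt0 addr_gt0// exprn_gt0.
have np0 m s x : (0 <= (normal_pdf m s x)%:E :> \bar R)%E.
  by rewrite lee_fin normal_pdf_ge0.
have mnp : measurable_fun [set: R * R] (fun p : R * R => normal_pdf p.1 b p.2).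
  rewrite (_ : (fun p => _) = normal_pdf 0 b \o (fun p : R * R => p.2 - p.1)).
    apply: measurableT_comp; first exact: measurable_normal_pdf.
    exact: measurable_funB.
  apply/funext => p/=; rewrite !normal_pdfE ?gt_eqF//.
  by rewrite /normal_fun subr0.
have mnp1 m s : measurable_fun [set: R] (EFin \o normal_pdf m s).
  by apply/measurable_EFinP; exact: measurable_normal_pdf.
pose F (p : R * R) := (f p.2 * (normal_pdf p.1 b p.2)%:E)%E.
have mF : measurable_fun setT F.
  apply: emeasurable_funM; first exact: measurableT_comp.
  exact/measurable_EFinP.
have F0 p : (0 <= F p)%E by rewrite mule_ge0.
pose G x := (\int[mu]_y F (x, y))%E.
have mG : measurable_fun setT G by exact: measurable_fun_fubini_tonelli_F.
have G0 x : (0 <= G x)%E by exact: integral_ge0.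
transitivity (\int[gamma]_x G (0 + a * x)%R)%E.
  apply: eq_integral => x _; rewrite add0r.
  rewrite -(@ge0_integral_normal_affine (a * x) b f b0 mf f0).
  exact: ge0_integral_normal_prob.
rewrite -(@ge0_integral_normal_affine 0 a G a0 mG G0).
rewrite (@ge0_integral_normal_prob 0 a G mG G0).
transitivity (\int[mu]_x \int[mu]_y (F (x, y) * (normal_pdf 0 a x)%:E))%E.
  apply: eq_integral => x _; rewrite [RHS]ge0_integralZr//.
  exact: measurableT_comp mF _.
have mFa : measurable_fun setT (fun p : R * R => (F p * (normal_pdf 0 a p.1)%:E))%E.
  by apply: emeasurable_funM => //; exact: (measurableT_comp (mnp1 0 a)).
transitivity (\int[mu]_y \int[mu]_x (F (x, y) * (normal_pdf 0 a x)%:E))%E.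
  apply: (@fubini_tonelli _ _ _ _ _ mu mu _ mFa).
  by move=> p; rewrite mule_ge0.
transitivity (\int[normal_prob 0 c]_y f y)%E; last first.
  rewrite (@ge0_integral_normal_affine 0 c f c0 mf f0).
  by apply: eq_integral => z _; rewrite add0r.
rewrite (@ge0_integral_normal_prob 0 c f mf f0).
apply: eq_integral => y _; rewrite /F/=.
transitivity (\int[mu]_x (f y * (normal_pdf 0 c y)%:E *
    (normal_pdf (a ^+ 2 / c ^+ 2 * y) (a * b / c) x)%:E))%E.
  apply: eq_integral => x _; rewrite -!muleA -!EFinM; congr (_ * _%:E)%E.
  by rewrite mulrC (normal_pdf_convolution _ _ a0 b0 c0 cE).
rewrite ge0_integralZl//; [|exact: mnp1|by rewrite mule_ge0].
by rewrite integral_normal_pdf mule1.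
Qed.

End Gaussian.

Lemma measurable_sqrt (R : realType) : measurable_fun setT (@Num.sqrt R).
Proof. by apply: continuous_measurable_fun; exact: sqrt_continuous. Qed.

Section GaussianSums.
Context d d' (T : measurableType d) (U : measurableType d') (R : realType).
Variables (P : probability T R) (u : T -> U).
Hypothesis mu : measurable_fun setT u.
Local Notation gamma := (normal_prob (0 : R) 1).

Variables (n : nat) (D : nat -> T -> R) (Om : set T) (c : nat -> U -> R).
Hypothesis mD : forall l, measurable_fun setT (D l).
Hypothesis mOm : measurable Om.
Hypothesis mc : forall l, measurable_fun setT (c l).
Hypothesis c0 : forall l x, 0 <= c l x.
Hypothesis D_iid : forall (E : set U) (A : nat -> set R),
  measurable E -> (forall l, measurable (A l)) ->
  (P (u @^-1` E `&` Om `&` [set w | forall l, (l < n)%N -> A l (D l w)]) =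
   P (u @^-1` E `&` Om) * \prod_(l < n) gamma (A l))%E.

Let rect (A : nat -> set R) := [set w | forall l, (l < n)%N -> A l (D l w)].

Let measurable_rect A : (forall l, measurable (A l)) -> measurable (Om `&` rect A).
Proof.
move=> mA; apply: measurableI => //.
rewrite (_ : rect A = \bigcap_(l in [set l | (l < n)%N]) D l @^-1` A l) //.
apply: bigcap_measurableType => // l _.
by rewrite -[X in measurable X]setTI; exact: mD.
Qed.

Let sd k x := Num.sqrt (\sum_(l < k) c l x ^+ 2).

Let measurable_sd k : measurable_fun setT (sd k).
Proof.
apply: measurableT_comp; first exact: measurable_sqrt.
by apply: measurable_sum => l; apply: measurable_funX; exact: mc.
Qed.

Let X k w := \sum_(l < k) c l (u w) * D l w.

Let measurable_X k : measurable_fun setT (X k).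
Proof.
apply: measurable_sum => l; apply: measurable_funM => //.
exact: measurableT_comp.
Qed.

Let gauss k (h : U * R -> \bar R) :=
  (\int[P]_(w in Om) \int[gamma]_z h (u w, (sd k (u w) * z)%R))%E.

Let prod_gamma (A : nat -> set R) := (\prod_(l < n) gamma (A l))%E.

(** Induction on [k], with constraints [A l] kept on the increments not yet summed. These
    constraints make the induction work: applied with a constraint on [D k], the induction
    hypothesis shows that [D k] is independent of [u] and [X k] under [P] restricted to the event,
    so it can be integrated out and merged by convolution. *)
Lemma gaussian_partial_sum k A (h : U * R -> \bar R) : (k <= n)%N ->
  (forall l, measurable (A l)) -> (forall l, (l < k)%N -> A l = setT) ->
  measurable_fun setT h -> (forall p, 0 <= h p)%E ->
  (\int[P]_(w in Om `&` rect A) h (u w, X k w) = prod_gamma A * gauss k h)%E.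
Proof.
elim: k A h => [|k IH] A h kn mA A1 mh h0.
  have mh' : measurable_fun setT (fun x => h (x, 0)).
    by apply: measurableT_comp mh _; exact: measurable_fun_pair.
  rewrite /gauss.
  under [in RHS]eq_integral.
    move=> w _; under eq_integral do rewrite /sd big_ord0 sqrtr0 mul0r.
    rewrite (integral_probability_cst gamma); over.
  have X0 w : X 0%N w = 0 by rewrite /X big_ord0.
  under [in LHS]eq_integral do rewrite X0.
  rewrite -(ge0_integral_mrestr P (measurable_rect mA))//; last first.
    by apply: measurableT_comp mh' _.
  rewrite -(ge0_integral_mrestr P mOm)//; last by apply: measurableT_comp mh' _.
  rewrite -(ge0_integral_image_measure _ mu mh')//.
  rewrite -(ge0_integral_image_measure _ mu mh')//.
  have k0 : (0 <= prod_gamma A)%E by apply: prode_ge0.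
  have kfin : prod_gamma A \is a fin_num.
    apply: prode_fin_num => l _.
    by have := @fin_num_measure _ _ _ gamma (A l) (mA l).
  pose kap := NngNum (fine_ge0 k0).
  (* By [D_iid], the constraints only multiply the law of [u] on [Om] by the constant [kap]. *)
  transitivity (\int[mscale kap (image_measure (mrestr P mOm) mu)]_x h (x, 0%R))%E.
    apply: eq_measure_integral => E mE _.
    rewrite /= /mscale/= /image_measure /mrestr/= fineK//.
    by rewrite muleC -D_iid// setIA.
  by rewrite ge0_integral_mscale//= fineK.
have k_lt_n : (k < n)%N by [].
have A1' l : (l < k)%N -> A l = setT by move=> lk; apply: A1; rewrite ltnW.
pose mQ := measurable_rect mA.
pose Q : {finite_measure set T -> \bar R} := mrestr P mQ.
have mX' : measurable_fun setT (fun w => (u w, X k w)) by exact: measurable_fun_pair.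
have Q_ind B C : measurable B -> measurable C ->
    (Q ((fun w => (u w, X k w)) @^-1` B `&` D k @^-1` C) =
     Q ((fun w => (u w, X k w)) @^-1` B) * gamma C)%E.
  move=> mB mC.
  have IHB A' : (forall l, measurable (A' l)) ->
      (forall l, (l < k)%N -> A' l = setT) ->
      (P ((fun w => (u w, X k w)) @^-1` B `&` (Om `&` rect A')) =
       prod_gamma A' * gauss k (EFin \o \1_B))%E.
    move=> mA' A'1; rewrite -IH//; last 3 first.
    - exact: ltnW.
    - by apply/measurable_EFinP; exact: measurable_indic.
    - by move=> p; rewrite lee_fin.
    under eq_integral do rewrite /= -[\1_B _]/(\1_((fun w => (u w, X k w)) @^-1` B) _).
    have mrA' := measurable_rect mA'.
    have mXB : measurable ((fun w => (u w, X k w)) @^-1` B).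
      by rewrite -[X in measurable X]setTI; exact: mX'.
    by rewrite integral_indic.
  (* Since [A k] is trivial, requiring [D k] to lie in [C] amounts to replacing [A k] by [C], which
     is still an instance of the induction hypothesis. *)
  pose A' l := if l == k then C else A l.
  have mA' l : measurable (A' l) by rewrite /A'; case: ifP.
  have A'1 l : (l < k)%N -> A' l = setT.
    by move=> lk; rewrite /A' ltn_eqF//; exact: A1'.
  have rA' : rect A' = rect A `&` D k @^-1` C.
    apply/seteqP; split => [w rw|w [rw Cw] l ln]; last first.
      by rewrite /A'; case: eqP => [->|_]//; exact: rw.
    split => [l ln|]; last by have := rw _ k_lt_n; rewrite /A' eqxx.
    have := rw _ ln; rewrite /A'; case: eqP => [->|]//.
    by rewrite A1.
  have gA' : (prod_gamma A' = prod_gamma A * gamma C)%E.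
    rewrite /prod_gamma (bigD1 (Ordinal k_lt_n))//= [in RHS](bigD1 (Ordinal k_lt_n))//=.
    rewrite {1}/A' eqxx (A1 k)// (probability_setT gamma) mul1e muleC.
    congr (_ * _)%E; apply: eq_bigr => i ik; rewrite /A'.
    by case: eqP => // ik'; case/eqP: ik; exact: val_inj.
  rewrite /Q/= /mrestr -setIA (setIC (D k @^-1` _)) -setIA -rA' IHB// IHB// gA'.
  by rewrite -!muleA [(gamma C * _)%E]muleC.
have mc' : measurable_fun setT (fun q : (U * R) * R => c k q.1.1).
  by apply: measurableT_comp => //; exact: measurableT_comp.
pose H (q : (U * R) * R) := h (q.1.1, q.1.2 + c k q.1.1 * q.2).
have mH : measurable_fun setT H.
  apply: measurableT_comp mh _; apply: measurable_fun_pair.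
    exact: measurableT_comp.
  apply: measurable_funD; first exact: measurableT_comp.
  exact: measurable_funM.
have H0 q : (0 <= H q)%E by exact: h0.
pose h' (p : U * R) := (\int[gamma]_z H (p, z))%E.
have mh' : measurable_fun setT h' by exact: measurable_fun_fubini_tonelli_F.
have h'0 p : (0 <= h' p)%E by apply: integral_ge0.
(* [h'] is [h] with the contribution of [D k] averaged out. *)
transitivity (\int[P]_(w in Om `&` rect A) h' (u w, X k w))%E.
  rewrite -(ge0_integral_mrestr P mQ)//; last first.
    by apply: measurableT_comp mh _; exact: measurable_fun_pair.
  rewrite -(ge0_integral_mrestr P mQ)//; last exact: measurableT_comp mh' _.
  have E := @integral_independent _ _ _ _ _ _ R Q gamma _ _ H mX' (mD k) Q_ind mH H0.
  apply: etrans E; apply: eq_integral => w _.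
  by rewrite /H/= /X big_ord_recr.
rewrite IH//; last exact: ltnW.
congr (_ * _)%E; apply: eq_integral => w _; rewrite /h' /H/=.
rewrite (integral_gaussian_convolution (f := fun x => h (u w, x)))//.
- rewrite /sd big_ord_recr/= sqr_sqrtr// sumr_ge0// => i _; exact: sqr_ge0.
- exact: measurableT_comp mh _.
- exact: sqrtr_ge0.
Qed.

Lemma integral_gaussian_sum (h : U * R -> \bar R) :
  measurable_fun setT h -> (forall p, 0 <= h p)%E ->
  (\int[P]_(w in Om) h (u w, (\sum_(l < n) c l (u w) * D l w)%R) =
   \int[P]_(w in Om) \int[gamma]_z
     h (u w, (Num.sqrt (\sum_(l < n) c l (u w) ^+ 2) * z)%R))%E.
Proof.
move=> mh h0; have := @gaussian_partial_sum n (fun=> setT) h (leqnn n).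
rewrite (_ : rect _ = setT) ?setIT; last by apply/seteqP; split.
move=> ->//; rewrite /prod_gamma big1 ?mul1e// => i _.
exact: (probability_setT gamma).
Qed.

End GaussianSums.

(** * Random times *)

Lemma measurable_preimage d d' (T : measurableType d) (U : measurableType d')
    (f : T -> U) (B : set U) :
  measurable_fun setT f -> measurable B -> measurable (f @^-1` B).
Proof. by move=> mf mB; rewrite -[X in measurable X]setTI; exact: mf. Qed.

Lemma cvg_integral_unit d (T : measurableType d) (R : realType)
    (P : probability T R) (f_ : nat -> T -> \bar R) (f : T -> \bar R) :
  (forall k, measurable_fun setT (f_ k)) ->
  (forall k w, 0 <= f_ k w <= 1)%E ->
  (forall w, f_ ^~ w @ \oo --> f w) ->
  (\int[P]_w f_ k w)%E @[k --> \oo] --> (\int[P]_w f w)%E.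
Proof.
move=> mf f01 ff; apply: (@dominated_cvg _ _ _ P _ measurableT f_ f (cst 1%E)) => //.
- exact: finite_measure_integrable_cst.
- by move=> k w _; have /andP[f0 f1] := f01 k w; rewrite gee0_abs.
Qed.

Lemma measurable_nat_select d d' (T : measurableType d) (U : measurableType d')
    (f : nat -> T -> U) (q : T -> nat) :
  (forall k, measurable_fun setT (f k)) -> (forall k, measurable (q @^-1` [set k])) ->
  measurable_fun setT (fun w => f (q w) w).
Proof.
move=> mf mq _ B mB; rewrite setTI.
rewrite (_ : _ @^-1` _ = \bigcup_k (q @^-1` [set k] `&` f k @^-1` B)).
  by apply: bigcupT_measurable => k; apply: measurableI => //; exact: measurable_preimage.
apply/seteqP; split => [w /= fB|w [k _ [/= <- //]]].
by exists (q w).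
Qed.

Section Grid.
Context {R : realType}.
Implicit Types t x : R.

(** For positive [t] and nonnegative [x], this is the largest multiple of [t] that is at most [x].
    It discretizes both the heights along a path and the times of the Riemann sums. *)
Definition grid t x : R := t * (Num.truncn (x / t))%:R.

Lemma grid_ge0 t x : 0 <= t -> 0 <= grid t x.
Proof. by move=> t0; rewrite mulr_ge0. Qed.

Lemma grid_le t x : 0 < t -> 0 <= x -> grid t x <= x.
Proof.
move=> t0 x0; rewrite /grid mulrC -ler_pdivlMr//.
by rewrite truncn_le divr_ge0// ltW.
Qed.

Lemma grid_gt t x : 0 < t -> x - t < grid t x.
Proof.
move=> t0; rewrite ltrBlDr /grid -{3}(mulr1 t) -mulrDr natr1 mulrC -ltr_pdivrMr//.
exact: truncnS_gt.
Qed.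

Lemma grid_cvg x : 0 <= x -> grid k.+1%:R^-1 x @[k --> \oo] --> x.
Proof.
move=> x0; apply: (@squeeze_cvgr _ _ _ _ (fun k => x - k.+1%:R^-1) (cst x)).
- near=> k; rewrite grid_le ?invr_gt0// andbT.
  by rewrite ltW// grid_gt ?invr_gt0.
- rewrite -[X in _ --> X]subr0; apply: cvgB; first exact: cvg_cst.
  exact: cvg_harmonic.
- exact: cvg_cst.
Unshelve. all: by end_near. Qed.

End Grid.

Lemma measurable_truncn d (T : measurableType d) (R : realType) (f : T -> R) k :
  measurable_fun setT f -> measurable ((Num.truncn \o f) @^-1` [set k]).
Proof.
move=> mf.
have mg l : measurable ((Num.truncn \o f) @^-1` [set m | (l < m)%N]).
  rewrite (_ : _ @^-1` _ = f @^-1` `[l.+1%:R, +oo[%classic).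
    exact: measurable_preimage.
  by apply/seteqP; split => w /=; rewrite in_itv/= andbT truncn_gt_nat.
case: k => [|k].
  rewrite (_ : _ @^-1` _ = ~` ((Num.truncn \o f) @^-1` [set m | (0 < m)%N])).
    by apply: measurableC; exact: mg.
  by apply/seteqP; split => w /=; [move=> -> //|case: Num.truncn].
rewrite (_ : _ @^-1` _ = (Num.truncn \o f) @^-1` [set m | (k < m)%N]
   `\` (Num.truncn \o f) @^-1` [set m | (k.+1 < m)%N]).
  by apply: measurableD; exact: mg.
apply/seteqP; split => w /= => [->|[h1 /negP]]; first by split => //; rewrite ltnn.
by rewrite -leqNgt => h2; apply/eqP; rewrite eqn_leq h1 h2.
Qed.

Lemma measurable_grid d (T : measurableType d) (R : realType) (t : R) (f : T -> R) :
  measurable_fun setT f -> measurable_fun setT (grid t \o f).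
Proof.
move=> mf; apply: (@measurable_nat_select _ _ _ _ (fun k _ => t * k%:R)) => k.
  exact: measurable_cst.
apply: (@measurable_truncn _ _ _ (fun w => f w / t)).
exact: measurable_funM.
Qed.

Lemma within_continuous_cvg (R : realType) (A : set R) (f : R -> R)
    (x_ : nat -> R) (x : R) :
  {within A, continuous f} -> (forall k, A (x_ k)) -> A x ->
  x_ @ \oo --> x -> f (x_ k) @[k --> \oo] --> f x.
Proof.
move=> /subspace_continuousP cf Ax_ Ax xx; apply: cvg_comp (cf x Ax).
move=> B /xx [N _ NB]; exists N => // k Nk; exact: NB.
Qed.

(** Rounded down to a grid, the random time takes countably many values and stays in the interval
    where the path is continuous; refining the grid recovers the value at [r w]. *)
Lemma measurable_random_time d (T : measurableType d) (R : realType)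
    (B : R -> T -> R) (L r : T -> R) :
  (forall t, 0 <= t -> measurable_fun setT (fun w => B (Num.min t (L w)) w)) ->
  (forall w, {within `[0, L w], continuous (B ^~ w)}) ->
  measurable_fun setT r -> (forall w, 0 <= r w <= L w) ->
  measurable_fun setT (fun w => B (r w) w).
Proof.
move=> mB cB mr r0L.
have g0 k w : 0 <= grid k.+1%:R^-1 (r w) <= L w.
  have /andP[r0 rL] := r0L w.
  by rewrite grid_ge0//= (le_trans _ rL)// grid_le.
apply: (@measurable_fun_cvg _ _ _ _ (fun k w => B (grid k.+1%:R^-1 (r w)) w)).
  move=> k.
  (* The minimum is inserted because, at a fixed time, measurability is known only for the stopped
     path. *)
  have -> : (fun w => B (grid k.+1%:R^-1 (r w)) w) =
      (fun w => B (Num.min (grid k.+1%:R^-1 (r w)) (L w)) w).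
    by apply/funext => w; rewrite min_l//; case/andP: (g0 k w).
  pose f l w := B (Num.min (k.+1%:R^-1 * l%:R) (L w)) w.
  apply: (@measurable_nat_select _ _ _ _ f) => l.
    by apply: mB; rewrite mulr_ge0.
  apply: (@measurable_truncn _ _ _ (fun w => r w / k.+1%:R^-1)).
  exact: measurable_funM.
move=> w _; apply: within_continuous_cvg (cB w) _ _ _ => /=.
- by move=> k; rewrite in_itv/=; exact: g0.
- by rewrite in_itv/=; exact: r0L.
- by apply: grid_cvg; case/andP: (r0L w).
Qed.

(** * Conditionally Gaussian variables *)

Lemma measurable_comp2 d0 d1 d2 d3 (T0 : measurableType d0)
    (U : measurableType d1) (V : measurableType d2) (W : measurableType d3)
    (h : U -> V -> W) (f : T0 -> U) (g : T0 -> V) :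
  measurable_fun setT (fun p : U * V => h p.1 p.2) ->
  measurable_fun setT f -> measurable_fun setT g ->
  measurable_fun setT (fun w => h (f w) (g w)).
Proof.
move=> mh mf mg.
exact: (measurableT_comp mh (measurable_fun_pair mf mg)).
Qed.

Lemma integral_unit d0 (T0 : measurableType d0) (R : realType) (Q : probability T0 R)
    (f : T0 -> \bar R) : measurable_fun setT f ->
  (forall w, 0 <= f w <= 1)%E -> (0 <= \int[Q]_w f w <= 1)%E.
Proof.
move=> mf f01; rewrite integral_ge0/=; last by move=> w _; case/andP: (f01 w).
rewrite -[leRHS](integral_probability_cst Q); apply: ge0_le_integral => //.
- by move=> w _; case/andP: (f01 w).
- by move=> w _; case/andP: (f01 w).
Qed.

Section ConditionallyGaussian.
Context d d' (T : measurableType d) (U : measurableType d') (R : realType).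
Variables (P : probability T R) (u : T -> U).
Hypothesis mu : measurable_fun setT u.
Local Notation gamma := (normal_prob (0 : R) 1).

Definition test_kernel (h : U -> R -> R) : Prop :=
  [/\ measurable_fun setT (fun p : U * R => h p.1 p.2),
      forall x y, 0 <= h x y <= 1 & forall x, continuous (h x)].

(* Conditionally given [u], [X] is centered Gaussian with variance [V u].
   Testing against kernels that are continuous in their second argument makes
   the notion stable under pointwise limits, see [cond_gaussian_cvg]. *)
Definition cond_gaussian (X : T -> R) (V : U -> R) : Prop :=
  forall h, test_kernel h ->
  (\int[P]_w (h (u w) (X w))%:E =
   \int[P]_w \int[gamma]_z (h (u w) (Num.sqrt (V (u w)) * z))%:E)%E.

Lemma measurable_kernel_comp h (X : T -> R) : test_kernel h ->
  measurable_fun setT X -> measurable_fun setT (fun w => h (u w) (X w)).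
Proof.
move=> [mh _ _] mX.
exact: measurable_comp2.
Qed.

Lemma measurable_kernel_gauss h (V : U -> R) : test_kernel h ->
  measurable_fun setT V ->
  measurable_fun setT
    (fun x => \int[gamma]_z (h x (Num.sqrt (V x) * z))%:E)%E.
Proof.
move=> [mh h01 _] mV.
apply: (@measurable_fun_fubini_tonelli_F _ _ _ _ _ gamma
  (fun p : U * R => (h p.1 (Num.sqrt (V p.1) * p.2))%:E)).
  apply/measurable_EFinP; apply: (measurable_comp2 mh) => //.
  apply: measurable_funM => //.
  apply: measurableT_comp; first exact: measurable_sqrt.
  exact: measurableT_comp.
by move=> p; rewrite lee_fin; case/andP: (h01 p.1 (Num.sqrt (V p.1) * p.2)).
Qed.

Lemma kernel_gauss_unit h (V : U -> R) x : test_kernel h ->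
  (0 <= \int[gamma]_z (h x (Num.sqrt (V x) * z))%:E <= 1)%E.
Proof.
move=> [mh h01 _]; apply: (@integral_unit _ _ _ gamma) => [|z].
  by apply/measurable_EFinP; apply: (measurable_comp2 mh).
by rewrite !lee_fin.
Qed.

(** Dominated convergence with the bound 1, over [w] on the left and over both [z] and [w] on the
    right, using continuity of [h x] and of the square root. *)
Lemma cond_gaussian_cvg (X_ : nat -> T -> R) (V_ : nat -> U -> R) X V :
  (forall k, measurable_fun setT (X_ k)) ->
  (forall k, measurable_fun setT (V_ k)) ->
  (forall w, X_ ^~ w @ \oo --> X w) -> (forall x, V_ ^~ x @ \oo --> V x) ->
  (forall k, cond_gaussian (X_ k) (V_ k)) -> cond_gaussian X V.
Proof.
move=> mX mV cX cV cg h kh; have [mh h01 ch] := kh.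
have cl : (\int[P]_w (h (u w) (X_ k w))%:E @[k --> \oo] -->
    \int[P]_w (h (u w) (X w))%:E)%E.
  apply: cvg_integral_unit => [k|k w|w].
  - by apply/measurable_EFinP; exact: measurable_kernel_comp.
  - by rewrite !lee_fin.
  - apply: cvg_EFin; first by near=> k.
    by apply: (cvg_comp _ _ (cX w)); exact: ch.
have cr : (\int[P]_w \int[gamma]_z (h (u w) (Num.sqrt (V_ k (u w)) * z))%:E
    @[k --> \oo] -->
    \int[P]_w \int[gamma]_z (h (u w) (Num.sqrt (V (u w)) * z))%:E)%E.
  apply: cvg_integral_unit => [k|k w|w].
  - exact: (measurableT_comp (measurable_kernel_gauss kh (mV k)) mu).
  - exact: (kernel_gauss_unit (V_ k) (u w) kh).
  - apply: (@cvg_integral_unit _ _ _ gamma) => [k|k z|z].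
    + by apply/measurable_EFinP; apply: (measurable_comp2 mh).
    + by rewrite !lee_fin.
    + apply: cvg_EFin; first by near=> k.
      apply: (cvg_comp (fun k => Num.sqrt (V_ k (u w)) * z) (h (u w)) _ (ch _ _)).
      apply: cvgMl; apply: (cvg_comp _ _ (cV (u w))).
      exact: sqrt_continuous.
rewrite (funext (fun k => cg k h kh)) in cl.
exact: cvg_unique cl cr.
Unshelve. all: by end_near. Qed.

Lemma cond_gaussian_ae X Y V : measurable_fun setT X -> measurable_fun setT Y ->
  {ae P, forall w, X w = Y w} -> cond_gaussian X V -> cond_gaussian Y V.
Proof.
move=> mX mY XY cg h kh; rewrite -(cg h kh).
apply: ae_eq_integral => //.
- by apply/measurable_EFinP; exact: measurable_kernel_comp.
- by apply/measurable_EFinP; exact: measurable_kernel_comp.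
by apply: filterS XY => w -> _.
Qed.

End ConditionallyGaussian.

Lemma cvg_sum_ord (R : realType) n (f_ : nat -> nat -> R) (f : nat -> R) :
  (forall i, (i < n)%N -> f_ i @ \oo --> f i) ->
  (\sum_(i < n) f_ i k) @[k --> \oo] --> \sum_(i < n) f i.
Proof.
move=> ff; apply: cvg_big => [|i _]; first exact: add_continuous.
exact: ff.
Qed.

Lemma cvg_minr (R : realType) (f_ g_ : nat -> R) (f g : R) :
  f_ @ \oo --> f -> g_ @ \oo --> g -> Num.min (f_ k) (g_ k) @[k --> \oo] --> Num.min f g.
Proof.
move=> ff gg.
have -> : (fun k => Num.min (f_ k) (g_ k)) =
   (fun k => (f_ k + g_ k - `|f_ k - g_ k|) / 2).
  by apply/funext => k; rewrite minr_absE.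
rewrite minr_absE; apply: cvgM; last exact: cvg_cst.
by apply: cvgB; [exact: cvgD|apply: cvg_norm; exact: cvgB].
Qed.

Lemma measurable_truncn_preimage d (T : measurableType d) (R : realType)
    (f : T -> R) (S : set nat) :
  measurable_fun setT f -> measurable ((Num.truncn \o f) @^-1` S).
Proof.
move=> mf.
rewrite (_ : _ @^-1` S = \bigcup_(k in S) ((Num.truncn \o f) @^-1` [set k])).
  by apply: bigcup_measurable => k _; exact: measurable_truncn.
by apply/seteqP; split => [w Sw|w [k Sk /= kw]] /=; [exists (Num.truncn (f w))|rewrite kw].
Qed.

Lemma normal_prob_scale (R : realType) (s : R) (A : set R) : 0 < s ->
  measurable A ->
  normal_prob 0 s ((fun x => x / s) @^-1` A) = normal_prob 0 1 A.
Proof.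
move=> s0 mA.
have ms : measurable_fun setT (fun x : R => x / s) by exact: measurable_funM.
have mA' := measurable_preimage ms mA.
have E (m s' : R) (C : set R) : measurable C ->
    normal_prob m s' C = (\int[normal_prob m s']_x (\1_C x)%:E)%E.
  by move=> mC; rewrite integral_indic// setIT.
pose f (x : R) := (\1_((fun x => x / s) @^-1` A) x)%:E : \bar R.
have mf : measurable_fun setT f by apply/measurable_EFinP; exact: measurable_indic.
have f0 x : (0 <= f x)%E by rewrite lee_fin.
rewrite (E 0 s _ mA') (E 0 1 _ mA) (ge0_integral_normal_affine 0 s0 mf f0).
apply: eq_integral => x _; rewrite /f !indicE; congr (_%:R%:E).
congr nat_of_bool; rewrite -[LHS]/((0 + s * x) / s \in A).
by rewrite add0r mulrAC divff ?gt_eqF// mul1r.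
Qed.

Section BrownianAtRandomTimes.
Context d d' (T : measurableType d) (U : measurableType d') (R : realType).
Variables (P : probability T R) (u : T -> U).
Hypothesis mu : measurable_fun setT u.
Local Notation gamma := (normal_prob (0 : R) 1).

Variables (B : R -> T -> R) (L : U -> R).
Hypothesis mL : measurable_fun setT L.
Hypothesis L0 : forall x, 0 <= L x.
Hypothesis mB : forall t, 0 <= t ->
  measurable_fun setT (fun w => B (Num.min t (L (u w))) w).
Hypothesis cB : forall w, {within `[0, L (u w)], continuous (B ^~ w)}.
Hypothesis incrB : forall (n : nat) (t : nat -> R) (A : nat -> set R) (E : set U),
  t 0%N = 0 -> (forall i, (i < n)%N -> t i < t i.+1) ->
  (forall i, measurable (A i)) -> measurable E ->
  P (u @^-1` E `&` [set w | t n <= L (u w)] `&`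
     [set w | forall i, (i < n)%N -> A i (B (t i.+1) w - B (t i) w)])
  = (P (u @^-1` E `&` [set w | (t n <= L (u w))%R]) *
     \prod_(i < n) normal_prob 0%R (Num.sqrt (t i.+1 - t i)%R) (A i))%E.

Variables (p : nat) (a : nat -> R) (rho : nat -> U -> R).
Hypothesis a0 : forall j, 0 <= a j.
Hypothesis mrho : forall j, measurable_fun setT (rho j).
Hypothesis rhoL : forall j x, 0 <= rho j x <= L x.

Section Discretization.
Variable t : R.
Hypothesis t0 : 0 < t.

Let q j x := Num.truncn (rho j x / t).
(** [incrB] concerns a fixed number of steps on the event that they fit below [L]. The space is
    therefore cut according to the number of whole steps of length [t] contained in [L]. *)
Let Om n := u @^-1` [set x | Num.truncn (L x / t) = n].

Let mOmU n : measurable [set x | Num.truncn (L x / t) = n].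
Proof.
apply: (@measurable_truncn_preimage _ _ _ (fun x => L x / t) [set n]).
exact: measurable_funM.
Qed.

Let mOm n : measurable (Om n).
Proof. exact: measurable_preimage. Qed.

Let Om_le n w l : Om n w -> (l <= n)%N -> t * l%:R <= L (u w).
Proof.
rewrite /Om /= => <- ln; rewrite mulrC -ler_pdivlMr//.
by rewrite -truncn_ge_nat// divr_ge0 ?(ltW t0)//.
Qed.

Let q_le n w j : Om n w -> (q j (u w) <= n)%N.
Proof.
rewrite /Om /= => <-; have /andP[r0 rL] := rhoL j (u w).
rewrite truncn_ge_nat ?divr_ge0 ?(ltW t0)//.
apply: (@le_trans _ _ (rho j (u w) / t)); last by rewrite ler_pM2r// invr_gt0.
by rewrite truncn_le divr_ge0 ?(ltW t0)//.
Qed.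

(** Stopping at [L] makes the increment measurable on the whole space; on [Om n] it has no effect
    for [l < n]. *)
Let D l w := (B (Num.min (t * l.+1%:R) (L (u w))) w -
              B (Num.min (t * l%:R) (L (u w))) w) / Num.sqrt t.
(** The [l]-th increment counts with weight [a j] for each [j] whose rounded time lies beyond it;
    the factor [Num.sqrt t] undoes the normalization in [D]. *)
Let c l x := Num.sqrt t * \sum_(j < p) a j * (l < q j x)%N%:R.

Let mD l : measurable_fun setT (D l).
Proof.
apply: measurable_funM => //; apply: measurable_funB; apply: mB;
  by rewrite mulr_ge0// ltW.
Qed.

Let mc l : measurable_fun setT (c l).
Proof.
apply: measurable_funM => //; apply: measurable_sum => j.
apply: measurable_funM => //.
pose S := (Num.truncn \o (fun x => rho j x / t)) @^-1` [set m | (l < m)%N].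
rewrite (_ : (fun x => _) = \1_S).
  apply: measurable_indic; apply: measurable_truncn_preimage.
  exact: measurable_funM.
apply/funext => x; rewrite indicE; congr (_%:R).
congr nat_of_bool; by rewrite -[RHS]/(`[< is_true (l < q j x)%N >]) asboolb.
Qed.

Let c0 l x : 0 <= c l x.
Proof. by rewrite mulr_ge0// sumr_ge0// => j _; rewrite mulr_ge0. Qed.

Let DE n w l : Om n w -> (l < n)%N ->
  D l w = (B (t * l.+1%:R) w - B (t * l%:R) w) / Num.sqrt t.
Proof. by move=> Onw ln; rewrite /D !min_l// (Om_le Onw)// ltnW. Qed.

Let D_iid n (E : set U) (A : nat -> set R) :
  measurable E -> (forall l, measurable (A l)) ->
  (P (u @^-1` E `&` Om n `&` [set w | forall l, (l < n)%N -> A l (D l w)]) =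
   P (u @^-1` E `&` Om n) * \prod_(l < n) gamma (A l))%E.
Proof.
move=> mE mA.
have st : 0 < Num.sqrt t by rewrite sqrtr_gt0.
pose A' l := (fun x => x / Num.sqrt t) @^-1` A l.
have mA' l : measurable (A' l).
  by apply: measurable_preimage => //; exact: measurable_funM.
(* [Om n] is determined by [u], so it can be absorbed into the conditioning event; it already
   implies that [n] steps fit below [L]. *)
pose E' := E `&` [set x | Num.truncn (L x / t) = n].
have mE' : measurable E' by apply: measurableI.
have incr i : (i < n)%N -> t * i%:R < t * i.+1%:R by rewrite ltr_pM2l// ltr_nat.
have := @incrB n (fun i => t * i%:R) A' E' (mulr0 t) incr mA' mE'.
have OmE : u @^-1` E' `&` [set w | t * n%:R <= L (u w)] = u @^-1` E `&` Om n.
  apply/seteqP; split => [w [[Ew On] _]|w [Ew On]]; first by split.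
  by split; [split|exact: (Om_le On)].
rewrite OmE => H.
transitivity (P (u @^-1` E `&` Om n `&`
   [set w | forall i, (i < n)%N -> A' i (B (t * i.+1%:R) w - B (t * i%:R) w)])).
  congr (P _); apply/seteqP; split => w [[Ew On] Aw]; split => // l ln;
    by have := Aw l ln; rewrite /A' /= (DE On).
rewrite H; congr (_ * _)%E; apply: eq_bigr => l _.
rewrite -mulrBr -natrB// subSnn mulr1; exact: normal_prob_scale.
Qed.

Let sum_lt n m (f : nat -> R) : (m <= n)%N ->
  \sum_(l < n) (l < m)%N%:R * f l = \sum_(l < m) f l.
Proof.
move=> mn; rewrite (big_ord_widen n _ mn) [RHS]big_mkcond /=.
by apply: eq_bigr => l _; case: ifP; rewrite ?mul1r ?mul0r.
Qed.

(** The increment of [B] from 0 to the [j]-th rounded time telescopes into [q j] mesh increments;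
    exchange the two sums. *)
Let sumD n w : Om n w ->
  \sum_(l < n) c l (u w) * D l w =
  \sum_(j < p) a j * (B (grid t (rho j (u w))) w - B 0 w).
Proof.
move=> On; have st : Num.sqrt t != 0 by rewrite gt_eqF// sqrtr_gt0.
transitivity (\sum_(l < n) \sum_(j < p)
    (l < q j (u w))%N%:R * (a j * (B (t * l.+1%:R) w - B (t * l%:R) w))).
  apply: eq_bigr => l _; rewrite (DE On)// /c mulrC mulrA divfK//.
  by rewrite mulr_sumr; apply: eq_bigr => j _; rewrite mulrC -mulrA mulrCA mulrA.
rewrite exchange_big; apply: eq_bigr => j _.
rewrite (sum_lt (fun l => a j * (B (t * l.+1%:R) w - B (t * l%:R) w)))//; last exact: q_le.
rewrite -mulr_sumr; congr (_ * _).
rewrite -(big_mkord xpredT (fun l => B (t * l.+1%:R) w - B (t * l%:R) w)).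
rewrite (telescope_sumr (fun l => B (t * l%:R) w))//.
by rewrite mulr0.
Qed.

(** Expanding the square, the pair [(i, j)] contributes [a i * a j * t] once for each [l] below both
    [q i] and [q j], which produces the minimum of the rounded times. *)
Let sumc n w : Om n w ->
  \sum_(l < n) c l (u w) ^+ 2 =
  \sum_(i < p) \sum_(j < p)
      a i * a j * Num.min (grid t (rho i (u w))) (grid t (rho j (u w))).
Proof.
move=> On.
transitivity (\sum_(l < n) \sum_(i < p) \sum_(j < p)
   (l < minn (q i (u w)) (q j (u w)))%N%:R * (a i * a j * t)).
  apply: eq_bigr => l _; rewrite /c exprMn sqr_sqrtr ?(ltW t0)//.
  rewrite expr2 mulr_suml mulr_sumr; apply: eq_bigr => i _.
  rewrite mulr_sumr mulr_sumr; apply: eq_bigr => j _.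
  rewrite leq_min; case: (_ < _)%N; case: (_ < _)%N;
    by rewrite ?(mulr1, mulr0, mul1r, mul0r)// mulrC.
rewrite exchange_big; apply: eq_bigr => i _.
rewrite exchange_big; apply: eq_bigr => j _.
rewrite (sum_lt (fun=> a i * a j * t)) ?geq_min ?(q_le _ On)//.
rewrite sumr_const card_ord -mulr_natr -mulrA; congr (_ * _).
rewrite /grid -minr_pMr ?(ltW t0)//; congr (_ * _).
by rewrite -natr_min.
Qed.

Lemma integral_brownian_grid (h : U * R -> \bar R) :
  measurable_fun setT h -> (forall x, 0 <= h x)%E ->
  measurable_fun setT
    (fun w => \sum_(j < p) a j * (B (grid t (rho j (u w))) w - B 0 w)) ->
  (\int[P]_w h (u w, (\sum_(j < p) a j * (B (grid t (rho j (u w))) w - B 0 w))%R) =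
   \int[P]_w \int[gamma]_z h (u w, (Num.sqrt (\sum_(i < p) \sum_(j < p)
      a i * a j * Num.min (grid t (rho i (u w))) (grid t (rho j (u w)))) * z)%R))%E.
Proof.
move=> mh h0 mX.
have OmT : [set: T] = \bigcup_n Om n.
  by apply/seteqP; split => // w _; exists (Num.truncn (L (u w) / t)).
have tOm : trivIset setT Om.
  apply/trivIsetP => i j _ _ /eqP ij; rewrite -subset0 => w [/= wi wj].
  by apply: ij; rewrite -wi -wj.
pose V x := \sum_(i < p) \sum_(j < p)
      a i * a j * Num.min (grid t (rho i x)) (grid t (rho j x)).
have mV : measurable_fun setT V.
  apply: measurable_sum => i; apply: measurable_sum => j.
  apply: measurable_funM => //.
  apply: measurable_minr; exact: measurable_grid.
have mH : measurable_fun setT (fun x => \int[gamma]_z h (x, (Num.sqrt (V x) * z)%R))%E.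
  apply: (@measurable_fun_fubini_tonelli_F _ _ _ _ _ gamma
    (fun p : U * R => h (p.1, (Num.sqrt (V p.1) * p.2)%R))) => //.
  apply: measurableT_comp mh _; apply: measurable_fun_pair => //.
  apply: measurable_funM => //.
  apply: measurableT_comp; first exact: measurable_sqrt.
  exact: measurableT_comp.
rewrite OmT !ge0_integral_bigcup//; last 3 first.
- by rewrite -OmT; exact: (measurableT_comp mH mu).
- by move=> w _; exact: integral_ge0.
- by rewrite -OmT; apply: measurableT_comp mh _; exact: measurable_fun_pair.
apply: eq_eseriesr => n _.
have E := @integral_gaussian_sum _ _ _ _ _ P u mu n D (Om n) c mD (mOm n) mc c0
  (@D_iid n) h mh h0.
transitivity (\int[P]_(w in Om n) h (u w, (\sum_(l < n) c l (u w) * D l w)%R))%E.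
  by apply: eq_integral => w; rewrite inE => On; rewrite (sumD On).
rewrite E; apply: eq_integral => w; rewrite inE => On; rewrite (sumc On).
by [].
Qed.
End Discretization.

(** The formula is the Brownian covariance [min], applied at times known from [u]. It is exact for
    rounded times by [integral_brownian_grid], and path continuity carries it to the limit. *)
Lemma cond_gaussian_brownian :
  cond_gaussian P u (fun w => \sum_(j < p) a j * (B (rho j (u w)) w - B 0 w))
    (fun x => \sum_(i < p) \sum_(j < p) a i * a j * Num.min (rho i x) (rho j x)).
Proof.
have gl k j x : 0 <= grid k.+1%:R^-1 (rho j x) <= L x.
  have /andP[r0 rL] := rhoL j x.
  by rewrite grid_ge0//= (le_trans _ rL)// grid_le.
have mBr (r : U -> R) : measurable_fun setT r -> (forall x, 0 <= r x <= L x) ->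
    measurable_fun setT (fun w => B (r (u w)) w).
  move=> mr r0L; apply: (@measurable_random_time _ _ _ B (L \o u) (r \o u)) => //.
    exact: measurableT_comp.
  by move=> w; exact: r0L.
have mg k j : measurable_fun setT (fun x => grid k.+1%:R^-1 (rho j x)).
  exact: measurable_grid.
have mB0 : measurable_fun setT (B 0).
  by apply: (mBr (cst 0)) => // x; rewrite lexx L0.
have mX k : measurable_fun setT
    (fun w => \sum_(j < p) a j * (B (grid k.+1%:R^-1 (rho j (u w))) w - B 0 w)).
  apply: measurable_sum => j; apply: measurable_funM => //.
  apply: measurable_funB => //.
  exact: (mBr (fun x => grid k.+1%:R^-1 (rho j x))).
apply: (@cond_gaussian_cvg _ _ _ _ _ _ _ mu
  (fun k w => \sum_(j < p) a j * (B (grid k.+1%:R^-1 (rho j (u w))) w - B 0 w))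
  (fun k x => \sum_(i < p) \sum_(j < p)
     a i * a j * Num.min (grid k.+1%:R^-1 (rho i x)) (grid k.+1%:R^-1 (rho j x)))).
- exact: mX.
- move=> k; apply: measurable_sum => i; apply: measurable_sum => j.
  by apply: measurable_funM => //; exact: measurable_minr.
- move=> w; apply: (cvg_sum_ord (f_ := fun j k => a j * (B (grid k.+1%:R^-1 (rho j (u w))) w - B 0 w))
    (f := fun j => a j * (B (rho j (u w)) w - B 0 w))) => j _.
  have gj k : `[0, L (u w)]%classic (grid k.+1%:R^-1 (rho j (u w))).
    by rewrite /= in_itv/=; exact: gl.
  have rj : `[0, L (u w)]%classic (rho j (u w)) by rewrite /= in_itv/=; exact: rhoL.
  have cj : grid k.+1%:R^-1 (rho j (u w)) @[k --> \oo] --> rho j (u w).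
    by apply: grid_cvg; case/andP: (rhoL j (u w)).
  have H := within_continuous_cvg (@cB w) gj rj cj.
  apply: cvgM; first exact: cvg_cst.
  by apply: cvgB; [exact: H|exact: cvg_cst].
- move=> x.
  apply: (cvg_sum_ord (f_ := fun i k => \sum_(j < p)
     a i * a j * Num.min (grid k.+1%:R^-1 (rho i x)) (grid k.+1%:R^-1 (rho j x)))
     (f := fun i => \sum_(j < p) a i * a j * Num.min (rho i x) (rho j x))) => i _.
  apply: (cvg_sum_ord (f_ := fun j k =>
     a i * a j * Num.min (grid k.+1%:R^-1 (rho i x)) (grid k.+1%:R^-1 (rho j x)))
     (f := fun j => a i * a j * Num.min (rho i x) (rho j x))) => j _.
  apply: cvgM; first exact: cvg_cst.
  by apply: cvg_minr; apply: grid_cvg; [case/andP: (rhoL i x)|case/andP: (rhoL j x)].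
move=> k h [mh h01 _].
have t0 : 0 < k.+1%:R^-1 :> R by rewrite invr_gt0.
apply: (integral_brownian_grid t0 (h := fun p : U * R => (h p.1 p.2)%:E)) => //.
- exact/measurable_EFinP.
- by move=> x; rewrite lee_fin; case/andP: (h01 x.1 x.2).
Qed.

End BrownianAtRandomTimes.

Section Chain.
Context d d1 d2 (T : measurableType d) (U1 : measurableType d1)
  (U2 : measurableType d2) (R : realType).
Variables (P : probability T R) (u1 : T -> U1) (u2 : T -> U2) (pr : U2 -> U1).
Hypotheses (mpr : measurable_fun setT pr) (pr_u2 : forall w, pr (u2 w) = u1 w).
Local Notation gamma := (normal_prob (0 : R) 1).

(** Taken real-valued through [fine], so that the average can itself serve as a test kernel and the
    conditional law can be used a second time. *)
Let mean (h : U1 -> R -> R) (V : U1 -> R) (x : U1) (y : R) : R :=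
  fine (\int[gamma]_z (h x (y + Num.sqrt (V x) * z))%:E)%E.

Let shift_kernel (h : U1 -> R -> R) y : test_kernel h ->
  test_kernel (fun x z => h x (y + z)).
Proof.
move=> [mh h01 ch]; split => //.
- by apply: (measurable_comp2 mh) => //; exact: measurable_funD.
- move=> x z; apply: (cvg_comp (fun z => y + z) (h x) _ (ch x _)).
  by apply: cvgD; [exact: cvg_cst|exact: cvg_id].
Qed.

Let meanE h V x y : test_kernel h ->
  ((mean h V x y)%:E = \int[gamma]_z (h x (y + Num.sqrt (V x) * z))%:E)%E.
Proof.
move=> kh; have /andP[m0 m1] := kernel_gauss_unit V x (shift_kernel y kh).
rewrite /mean fineK// ge0_fin_numE//.
by apply: le_lt_trans m1 _; rewrite ltry.
Qed.

Let mean_kernel h V : measurable_fun setT V -> test_kernel h ->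
  test_kernel (mean h V).
Proof.
move=> mV kh; have [mh h01 ch] := kh; split.
- apply/measurable_EFinP.
  rewrite (_ : EFin \o _ = fun p : U1 * R =>
    \int[gamma]_z (h p.1 (p.2 + Num.sqrt (V p.1) * z))%:E)%E; last first.
    by apply/funext => p /=; rewrite meanE.
  apply: (@measurable_fun_fubini_tonelli_F _ _ _ _ _ gamma
    (fun q : (U1 * R) * R => (h q.1.1 (q.1.2 + Num.sqrt (V q.1.1) * q.2))%:E)).
    apply/measurable_EFinP; apply: (measurable_comp2 mh).
      exact: measurableT_comp.
    apply: measurable_funD; first exact: measurableT_comp.
    apply: measurable_funM => //.
    apply: measurableT_comp; first exact: measurable_sqrt.
    by apply: measurableT_comp => //; exact: measurableT_comp.
  by move=> q; rewrite lee_fin; case/andP: (h01 q.1.1 (q.1.2 + Num.sqrt (V q.1.1) * q.2)).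
- move=> x y; rewrite -!lee_fin meanE//.
  exact: (kernel_gauss_unit V x (shift_kernel y kh)).
(* Continuity is checked along sequences, where dominated convergence applies. *)
move=> x y; apply/(@cvg_nbhsP _ R^o) => v vy.
apply: fine_cvg; rewrite [X in _ --> X](meanE V x y kh).
apply: (@cvg_integral_unit _ _ _ gamma) => [k|k z|z].
- apply/measurable_EFinP; apply: (measurable_comp2 mh) => //.
  by apply: measurable_funD => //; exact: measurable_funM.
- by rewrite !lee_fin.
- apply: cvg_EFin; first by near=> k.
  apply: (cvg_comp (fun k => v k + Num.sqrt (V x) * z) (h x) _ (ch x _)).
  by apply: cvgD => //; exact: cvg_cst.
Unshelve. all: by end_near. Qed.

(** Conditioning in two stages, [u2] being finer than [u1]. Given [u2], the variable [Y] is known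
    and [D] is averaged out; since the variance of [D] factors through [pr], what remains is a
    kernel in [u1] and [Y]. Averaging [Y] given [u1] is then a Gaussian convolution. *)
Lemma cond_gaussian_chain (Y : U2 -> R) (D : T -> R) (V W : U1 -> R) :
  measurable_fun setT Y -> measurable_fun setT V -> measurable_fun setT W ->
  (forall x, 0 <= V x) -> (forall x, 0 <= W x) ->
  cond_gaussian P u1 (Y \o u2) V -> cond_gaussian P u2 D (W \o pr) ->
  cond_gaussian P u1 (fun w => Y (u2 w) + D w) (fun x => V x + W x).
Proof.
move=> mY mV mW V0 W0 cgY cgD h kh; have [mh h01 ch] := kh.
(* [D] is tested against [h] translated by [Y], a kernel over the finer information. *)
have kh2 : test_kernel (fun x y => h (pr x) (Y x + y)).
  split => //.
  - apply: (measurable_comp2 mh); first exact: measurableT_comp.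
    by apply: measurable_funD => //; exact: measurableT_comp.
  - move=> x z; apply: (cvg_comp (fun z => Y x + z) (h (pr x)) _ (ch _ _)).
    by apply: cvgD; [exact: cvg_cst|exact: cvg_id].
transitivity (\int[P]_w (mean h W (u1 w) (Y (u2 w)))%:E)%E.
  have := cgD _ kh2; under eq_integral do rewrite pr_u2.
  move=> ->; apply: eq_integral => w _; rewrite meanE//.
  by apply: eq_integral => z _; rewrite /= pr_u2.
rewrite (cgY _ (mean_kernel mW kh)); apply: eq_integral => w _.
under eq_integral do rewrite meanE//.
rewrite (@integral_gaussian_convolution R (Num.sqrt (V (u1 w))) (Num.sqrt (W (u1 w)))
  (fun x => (h (u1 w) x)%:E)) ?sqrtr_ge0//.
- by under eq_integral do rewrite !sqr_sqrtr//.
- by apply/measurable_EFinP; exact: (measurable_comp2 mh).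
- by move=> x; rewrite lee_fin; case/andP: (h01 (u1 w) x).
Qed.

End Chain.

(** * The snake *)

Section PathMin.
Context d (T : measurableType d) (R : realType).
Variable X : R -> T -> R.
Hypothesis X0 : forall t w, 0 <= t <= 1 -> 0 <= X t w.

Lemma path_min_le s t u w : 0 <= s -> t <= 1 -> s <= u <= t ->
  path_min X s t w <= X u w.
Proof.
move=> s0 t1 /andP[su ut]; apply: ge_inf.
  exists 0 => y [v /=]; rewrite in_itv/= => /andP[sv vt] <-.
  by apply: X0; rewrite (le_trans s0 sv) (le_trans vt).
by exists u => //=; rewrite in_itv/= su ut.
Qed.

Lemma path_min_ge s t c w : s <= t ->
  (forall u, s <= u <= t -> c <= X u w) -> c <= path_min X s t w.
Proof.
move=> st cX; apply: lb_le_inf.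
  by exists (X s w), s => //=; rewrite in_itv/= lexx.
by move=> y [u /=]; rewrite in_itv/= => sut <-; exact: cX.
Qed.

Lemma path_min_ge0 s t w : 0 <= s -> s <= t -> t <= 1 -> 0 <= path_min X s t w.
Proof.
move=> s0 st t1; apply: path_min_ge => // u /andP[su ut].
by apply: X0; rewrite (le_trans s0 su) (le_trans ut).
Qed.

Lemma path_min_id s w : 0 <= s <= 1 -> path_min X s s w = X s w.
Proof.
move=> /andP[s0 s1]; apply/eqP; rewrite eq_le path_min_le ?lexx//=.
by apply: path_min_ge => // u; rewrite -eq_le => /eqP ->.
Qed.

Lemma path_min_sub s t s' t' w : 0 <= s -> s <= s' -> s' <= t' -> t' <= t -> t <= 1 ->
  path_min X s t w <= path_min X s' t' w.
Proof.
move=> s0 ss st tt t1; apply: path_min_ge => // u /andP[su ut].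
by apply: path_min_le => //; rewrite (le_trans ss su) (le_trans ut).
Qed.

Lemma path_min_split s r t w : 0 <= s -> s <= r -> r <= t -> t <= 1 ->
  path_min X s t w = Num.min (path_min X s r w) (path_min X r t w).
Proof.
move=> s0 sr rt t1; apply/eqP; rewrite eq_le; apply/andP; split.
  by rewrite le_min !path_min_sub// (le_trans rt).
apply: path_min_ge => [|u /andP[su ut]]; first exact: le_trans rt.
have r1 := le_trans rt t1; have r0 := le_trans s0 sr.
rewrite ge_min; have [ur|ru] := leP u r.
  by rewrite path_min_le// su ur.
by rewrite (@path_min_le r t)// ?orbT// ut ltW.
Qed.

Hypothesis mX : forall t, 0 <= t <= 1 -> measurable_fun setT (X t).
Hypothesis cX : forall w, {within `[0, 1], continuous (X ^~ w)}.

(** By continuity, the infimum is below [a] exactly when some value at a time [s + i / (n + 1)] in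
    the interval is below [a]: a countable union of events. *)
Lemma measurable_path_min s t : 0 <= s -> s <= t -> t <= 1 ->
  measurable_fun setT (path_min X s t).
Proof.
move=> s0 st t1; apply: (measurability _ (RGenInftyO.measurableE R)).
move=> _ [_ [a ->] <-]; rewrite setTI.
pose v n i : R := s + n.+1%:R^-1 * i%:R.
have v01 n i : v n i <= t -> 0 <= v n i <= 1.
  by move=> vt; rewrite (le_trans vt)// andbT addr_ge0// mulr_ge0.
rewrite (_ : _ @^-1` _ = \bigcup_n \bigcup_(i in [set i | v n i <= t])
  (X (v n i) @^-1` `]-oo, a[)).
  apply: bigcupT_measurable => n; apply: bigcup_measurable => i /= vt.
  by apply: measurable_preimage => //; apply: mX; exact: v01.
apply/seteqP; split => w /=; rewrite in_itv/=; last first.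
  move=> [n _ [i /= vt]]; rewrite in_itv/=; apply: le_lt_trans.
  by apply: path_min_le => //; rewrite vt lerDl mulr_ge0.
have S0 : [set X u w | u in `[s, t]] !=set0.
  by exists (X s w), s => //=; rewrite in_itv/= lexx.
move=> /(inf_lt S0)[].
move=> y [u /=]; rewrite in_itv/= => /andP[su ut] <- Xua.
have us0 : 0 <= u - s by rewrite subr_ge0.
have gu k : s + grid k.+1%:R^-1 (u - s) <= u.
  by rewrite -lerBrDl grid_le.
have cu : (X (s + grid k.+1%:R^-1 (u - s)) w @[k --> \oo] --> X u w).
  apply: (@within_continuous_cvg _ _ _ (fun k => s + grid k.+1%:R^-1 (u - s)) _ (@cX w)).
  - move=> k; rewrite /= in_itv/= addr_ge0 ?grid_ge0//=.
    by rewrite (le_trans (gu k))// (le_trans ut).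
  - by rewrite /= in_itv/= (le_trans s0 su) (le_trans ut).
  rewrite -[X in _ --> X](subrKC s u); apply: cvgD; first exact: cvg_cst.
  exact: grid_cvg.
have /cvgr_lt/(_ _ Xua)[N _ NX] := cu.
exists N => //; exists (Num.truncn ((u - s) / N.+1%:R^-1)).
  by rewrite /= (le_trans (gu N)).
by rewrite /= in_itv/=; exact: (NX N (leqnn N)).
Qed.

End PathMin.

(** This is how a sigma-algebra is conditioned on below: [u] is the identity into [T] equipped with
    it. *)
Lemma measurable_id_g_sigma d (T : measurableType d) (G : set (set T)) :
  G `<=` measurable -> measurable_fun setT (id : T -> g_sigma_algebraType G).
Proof.
move=> GM _ A mA; rewrite setTI; move: A mA.
by apply: smallest_sub => //; exact: sigma_algebra_measurable.
Qed.

Lemma measurable_g_sigma_process d (T : measurableType d) (R : realType)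
    (D : set R) (X : R -> T -> R) (G : set (set T)) t :
  process_events D X `<=` G -> D t ->
  measurable_fun setT (X t : g_sigma_algebraType G -> R).
Proof.
move=> XG Dt _ A mA; apply: sub_sigma_algebra; apply: XG.
by exists t => //; exists A.
Qed.

Section Snake.
Context d (T : measurableType d) (R : realType).
Variables (P : probability T R) (zeta : R -> T -> R) (W : R -> R -> T -> R).
Hypothesis mz : forall t, 0 <= t <= 1 -> measurable_fun setT (zeta t).
Hypothesis cz : forall w, {within `[0, 1], continuous (zeta ^~ w)}.
Hypothesis z0 : forall t w, 0 <= t <= 1 -> 0 <= zeta t w.
Hypothesis zeta_start : forall w, zeta 0 w = 0.
Hypothesis hW : brownian_snake P zeta W.

Let GZ : set (set T) := process_events `[0, 1] zeta.
Let GP s : set (set T) := GZ `|`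
  \bigcup_(u in `[0, s]) process_events `[0, +oo[ (stopped_path zeta W u).
Local Notation UZ := (g_sigma_algebraType GZ).
Local Notation UP s := (g_sigma_algebraType (GP s)).

Let GZ_measurable : GZ `<=` measurable.
Proof.
move=> A [t /= + [B mB <-]]; rewrite in_itv/= setTI => t01.
by apply: measurable_preimage => //; exact: mz.
Qed.

Let GP_measurable s : s <= 1 -> GP s `<=` measurable.
Proof.
move=> s1 A [/GZ_measurable//|[u /= + [t /= + [B mB <-]]]].
rewrite !in_itv/= setTI andbT => /andP[u0 us] t0.
apply: measurable_preimage => //; apply: (snake_measurable hW) => //.
by rewrite u0 (le_trans us).
Qed.

Let mid_Z : measurable_fun setT (id : T -> UZ).
Proof. exact: measurable_id_g_sigma. Qed.

Let mid_P s : s <= 1 -> measurable_fun setT (id : T -> UP s).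
Proof. by move=> s1; apply: measurable_id_g_sigma; exact: GP_measurable. Qed.

Let mid_PZ s : measurable_fun setT (id : UP s -> UZ).
Proof.
apply: (@measurable_id_g_sigma _ (UP s) GZ) => A GA.
by apply: sub_sigma_algebra; left.
Qed.

Let mzeta_Z t : 0 <= t <= 1 -> measurable_fun setT (zeta t : UZ -> R).
Proof. by move=> t01; apply: (measurable_g_sigma_process (D := `[0, 1])). Qed.

Let stopped_P s u t : 0 <= u <= s -> 0 <= t ->
  measurable_fun setT (stopped_path zeta W u t : UP s -> R).
Proof.
move=> us t0; apply: (measurable_g_sigma_process (D := `[0, +oo[)).
  by move=> A pA; right; exists u.
by rewrite /= in_itv/= andbT.
Qed.

Let mC_Z s t : 0 <= s -> s <= t -> t <= 1 ->
  measurable_fun setT (path_min zeta s t : UZ -> R).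
Proof.
move=> s0 st t1; apply: (@measurable_path_min _ UZ) => //.
Qed.

Lemma measurable_snake_past s u (r : T -> R) : 0 <= u <= s -> s <= 1 ->
  measurable_fun setT (r : UZ -> R) -> (forall w, 0 <= r w <= zeta u w) ->
  measurable_fun setT ((fun w => W u (r w) w) : UP s -> R).
Proof.
move=> /andP[u0 us] s1 mr r0.
apply: (@measurable_random_time _ (UP s) _ (W u) (zeta u) r) => //.
- by move=> t t0; apply: stopped_P => //; rewrite u0.
- have [|_ cW _] := @snake_path _ _ _ _ _ _ hW u; first by rewrite u0 (le_trans us).
  exact: cW.
- exact: (measurableT_comp mr (@mid_PZ s)).
Qed.

Lemma measurable_snake u (r : T -> R) : 0 <= u <= 1 ->
  measurable_fun setT r -> (forall w, 0 <= r w <= zeta u w) ->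
  measurable_fun setT (fun w => W u (r w) w).
Proof.
move=> u01 mr r0.
apply: (@measurable_random_time _ _ _ (W u) (zeta u) r) => //.
- by move=> t t0; exact: (snake_measurable hW).
- by have [_ cW _] := @snake_path _ _ _ _ _ _ hW u u01.
Qed.

Section Discrete.
Variable n : nat.

Let s j : R := j%:R / n.+1%:R.
Let a : R := n.+1%:R^-1.
Let C i j := path_min zeta (s i) (s j).

Let s_ge0 j : 0 <= s j. Proof. by rewrite divr_ge0. Qed.

Let s_le1 j : (j <= n)%N -> s j <= 1.
Proof. by move=> jn; rewrite ler_pdivrMr// mul1r ler_nat ltnW. Qed.

Let s_01 j : (j <= n)%N -> 0 <= s j <= 1.
Proof. by move=> jn; rewrite s_ge0 s_le1. Qed.

Let s_le i j : (i <= j)%N -> s i <= s j.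
Proof. by move=> ij; rewrite ler_pM2r// ler_nat. Qed.

Let s_lt i j : (i < j)%N -> s i < s j.
Proof. by move=> ij; rewrite ltr_pM2r// ltr_nat. Qed.

Let C_ge0 i j w : (i <= j)%N -> (j <= n)%N -> 0 <= C i j w.
Proof. by move=> ij jn; apply: path_min_ge0; rewrite ?s_le ?s_le1. Qed.

Let C_le i j w : (i <= j)%N -> (j <= n)%N -> C i j w <= zeta (s i) w.
Proof. by move=> ij jn; apply: path_min_le; rewrite ?lexx ?s_le ?s_le1. Qed.

Let C_sub i j i' j' w : (i <= i')%N -> (i' <= j')%N -> (j' <= j)%N -> (j <= n)%N ->
  C i j w <= C i' j' w.
Proof. by move=> ii ij jj jn; apply: path_min_sub; rewrite ?s_le ?s_le1. Qed.

Let C_id i w : (i <= n)%N -> C i i w = zeta (s i) w.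
Proof. by move=> ni; apply: path_min_id => //; exact: s_01. Qed.

Let C_split i k j w : (i <= k)%N -> (k <= j)%N -> (j <= n)%N ->
  C i j w = Num.min (C i k w) (C k j w).
Proof. by move=> ik kj jn; apply: path_min_split; rewrite ?s_le ?s_le1. Qed.

Let C0 j w : (j <= n)%N -> C 0%N j w = 0.
Proof.
move=> jn; apply/eqP; rewrite eq_le C_ge0// andbT.
by rewrite (le_trans (C_le _ _ jn))// /s mul0r zeta_start.
Qed.

Let mC i j : (i <= j)%N -> (j <= n)%N -> measurable_fun setT (C i j : UZ -> R).
Proof. by move=> ij jn; apply: mC_Z; rewrite ?s_le ?s_le1. Qed.

(* The part of the Riemann sum of the head that is visible from the path at
   time [s k]: the paths at later times are followed up to their splitting
   from it. *)
Let S k w := \sum_(j < n.+1) a *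
  (if (j < k)%N then snake_head zeta W (s j) w else W (s k) (C k j w) w).

(** The conditional variance of [S k]. For [i <= j], the visible parts of the two heads have
    covariance [C i j] when [i < k]; when [k <= i], both are read on the path at time [s k], at
    heights [C k i] and [C k j], the smaller of which is [C k j]. *)
Let V k w := \sum_(i < n.+1) \sum_(j < n.+1) a * a * C (minn (minn i j) k) (maxn i j) w.

Let mS k : (k <= n)%N -> measurable_fun setT (S k : UP (s k) -> R).
Proof.
move=> kn; apply: measurable_sum => j; apply: measurable_funM => //.
have jn : (j <= n)%N by rewrite -ltnS.
case: (boolP (j < k)%N) => jk.
  apply: measurable_snake_past; rewrite ?s_le1 ?s_ge0 ?s_le//; first exact: ltnW.
  - by apply: mzeta_Z; exact: s_01.
  - by move=> w; rewrite lexx andbT; apply: z0; exact: s_01.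
rewrite -leqNgt in jk.
apply: measurable_snake_past; rewrite ?s_le1 ?s_ge0 ?lexx//.
- exact: mC.
- by move=> w; rewrite C_ge0//= C_le.
Qed.

Let mV k : measurable_fun setT (V k : UZ -> R).
Proof.
apply: measurable_sum => i; apply: measurable_sum => j; apply: measurable_funM => //.
apply: mC; last by rewrite geq_max !leq_ord.
by rewrite (leq_trans (geq_minl _ _))// (leq_trans (geq_minl _ _))// leq_maxl.
Qed.

Let V_ge0 k w : 0 <= V k w.
Proof.
apply: sumr_ge0 => i _; apply: sumr_ge0 => j _.
apply: mulr_ge0; first by rewrite mulr_ge0// invr_ge0.
apply: C_ge0; last by rewrite geq_max !leq_ord.
by rewrite (leq_trans (geq_minl _ _))// (leq_trans (geq_minl _ _))// leq_maxl.
Qed.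

Section Step.
Variable k : nat.
Hypothesis kn : (k < n)%N.

Let m := C k k.+1.
Let B t w := W (s k.+1) (m w + t) w.
Let L w := zeta (s k.+1) w - m w.
(** The length of the new branch [B] followed by the path at time [s j] before splitting from it. It
    is 0 for [j <= k], whose heads are already visible; the value 0 beyond [n] keeps [rhoL] valid
    for every natural number. *)
Let rho j w := if (k < j <= n)%N then C k.+1 j w - C k j w else 0.
Let D w := \sum_(j < n.+1) a * (B (rho j w) w - B 0 w).
Let v w := \sum_(i < n.+1) \sum_(j < n.+1) a * a * Num.min (rho i w) (rho j w).

Let m_ge0 w : 0 <= m w. Proof. exact: C_ge0. Qed.

Let L_ge0 w : 0 <= L w.
Proof. by rewrite subr_ge0 -C_id// C_sub. Qed.

Let rho_ge0 j w : 0 <= rho j w.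
Proof.
rewrite /rho; case: ifPn => // /andP[kj jn].
by rewrite subr_ge0 C_sub.
Qed.

(** By [C_split], [C k j] is the smaller of [m w] and [C k.+1 j w]. *)
Let rhoE j w : (k < j)%N -> (j <= n)%N -> rho j w = Num.max 0 (C k.+1 j w - m w).
Proof.
move=> kj jn; rewrite /rho kj jn/= (@C_split k k.+1 j)// -/m.
have [h|h] := leP (m w) (C k.+1 j w); first by rewrite max_r ?subr_ge0.
by rewrite subrr max_l ?subr_le0 ?ltW.
Qed.

Let rhoL j w : 0 <= rho j w <= L w.
Proof.
rewrite rho_ge0/=; have [/andP[kj jn]|/negbTE h] := boolP (k < j <= n)%N.
  by rewrite rhoE// ge_max L_ge0/= lerD2r C_le.
by rewrite /rho h L_ge0.
Qed.

Let mm : measurable_fun setT (m : UZ -> R). Proof. exact: mC. Qed.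

Let mLZ : measurable_fun setT (L : UZ -> R).
Proof. by apply: measurable_funB => //; apply: mzeta_Z; exact: s_01. Qed.

Let mrho j : measurable_fun setT (rho j : UZ -> R).
Proof.
rewrite /rho; case: (boolP (k < j <= n)%N) => // /andP[kj jn].
by apply: measurable_funB; apply: mC => //; exact: ltnW.
Qed.

Let mB_random (r : T -> R) : measurable_fun setT (r : UZ -> R) ->
  (forall w, 0 <= r w <= L w) -> measurable_fun setT (fun w => B (r w) w).
Proof.
move=> mr r0; apply: measurable_snake; first exact: s_01.
  apply: (measurableT_comp (f := (fun w => m w + r w) : UZ -> R) _ mid_Z).
  exact: measurable_funD.
move=> w; have /andP[r0' rL] := r0 w.
by rewrite addr_ge0//= -lerBrDl.
Qed.

Let mD : measurable_fun setT D.
Proof.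
apply: measurable_sum => j; apply: measurable_funM => //.
apply: measurable_funB; first exact: mB_random.
by apply: mB_random => // w; rewrite lexx L_ge0.
Qed.

Let v_ge0 w : 0 <= v w.
Proof.
apply: sumr_ge0 => i _; apply: sumr_ge0 => j _.
by apply: mulr_ge0; [rewrite mulr_ge0// invr_ge0|rewrite le_min !rho_ge0].
Qed.

Let mv : measurable_fun setT (v : UZ -> R).
Proof.
apply: measurable_sum => i; apply: measurable_sum => j; apply: measurable_funM => //.
exact: measurable_minr.
Qed.

Let D_gaussian : cond_gaussian P (id : T -> UP (s k)) D v.
Proof.
have [B0 cB incr] := snake_branch hW (s_ge0 k) (s_lt (leqnn k.+1)) (s_le1 kn).
apply: (@cond_gaussian_brownian _ _ T (UP (s k)) R P id _ B L _ _ _ _ _ n.+1 (fun=> a) rho).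
- by apply: mid_P; exact/s_le1/ltnW.
- exact: (measurableT_comp mLZ (@mid_PZ _)).
- exact: L_ge0.
- move=> t t0; apply: (mB_random (r := fun w => Num.min t (L w))).
    exact: measurable_minr.
  by move=> w; rewrite le_min t0 L_ge0/= ge_min lexx orbT.
- exact: cB.
- exact: incr.
- by move=> j; rewrite invr_ge0.
- by move=> j; exact: (measurableT_comp (@mrho j) (@mid_PZ _)).
- exact: rhoL.
Qed.

Let S_step : {ae P, forall w, S k w + D w = S k.+1 w}.
Proof.
have [B0 cB incr] := snake_branch hW (s_ge0 k) (s_lt (leqnn k.+1)) (s_le1 kn).
have glue := snake_glue hW (s_ge0 k) (s_lt (leqnn k.+1)) (s_le1 kn).
apply: filterS2 B0 glue => w B0 glue.
rewrite -big_split/=; apply: eq_bigr => -[j /= jn] _.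
rewrite -mulrDr; congr (_ * _).
have [jk|kj] := leqP j k.
  have jk1 : (j < k.+1)%N by rewrite ltnS.
  rewrite jk1 /rho [(k < j)%N]ltnNge jk/= subrr addr0.
  (* For [j = k], the visible part at step [k] is already the whole path, since [C k k] is its
     lifetime. *)
  case: ltnP => // kj; have -> : j = k by apply/eqP; rewrite eqn_leq jk.
  by rewrite C_id// ltnW.
have jk1 : (j < k.+1)%N = false by rewrite ltnNge kj.
have jk0 : (j < k)%N = false by rewrite ltnNge ltnW.
have jn' : (j <= n)%N by rewrite -ltnS.
have B0' : B 0 w = W (s k) (m w) w := B0.
rewrite jk1 jk0 rhoE// (@C_split k k.+1 j)// -/m B0'.
(* If path [j] separates from path [k.+1] at height at least [m], it follows the new branch for the
   length [rho j]. Otherwise it separates on the part common to paths [k] and [k.+1], which [glue]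
   identifies. *)
have [h|h] := leP (m w) (C k.+1 j w).
  by rewrite max_r ?subr_ge0// /B subrKC addrC subrK.
rewrite max_l ?subr_le0 ?ltW// B0' subrr addr0; apply/esym/glue.
  by rewrite C_ge0.
exact: ltW.
Qed.

(** For [i <= j]: if [i <= k], neither term of the pair changes because [rho i] vanishes; if
    [k < i], the shorter piece is [rho j], and it raises [C k j] to [C k.+1 j]. *)
Let V_step w : V k w + v w = V k.+1 w.
Proof.
rewrite -big_split; apply: eq_bigr => i _; rewrite -big_split; apply: eq_bigr => j _.
rewrite /= -mulrDr; congr (_ * _).
have := leq_ord j; have := leq_ord i; move: (i : nat) (j : nat) => {}i {}j.
wlog ij : i j / (i <= j)%N => [H ni nj|ni nj].
  by case/orP: (leq_total i j) => ij; [|rewrite (minnC i) (maxnC i) (minC (rho i w))]; exact: H.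
rewrite (minn_idPl ij) (maxn_idPr ij); have [ik|ki] := leqP i k.
  rewrite (minn_idPl (leq_trans ik (leqnSn k))).
  by rewrite {1}/rho [(k < i)%N]ltnNge ik/= min_l ?addr0.
have kj : (k < j)%N := leq_trans ki ij.
rewrite (minn_idPr ki) min_r.
  by rewrite /rho kj nj/= subrKC.
by rewrite !rhoE// le_max2 ?lexx// lerD2r C_sub.
Qed.

(** [S k] is known from the past at time [s k], and the variance [v] of the increment [D] given that
    past depends on [zeta] alone, as [cond_gaussian_chain] requires. *)
Lemma cond_gaussian_step : cond_gaussian P (id : T -> UZ) (S k) (V k) ->
  cond_gaussian P (id : T -> UZ) (S k.+1) (V k.+1).
Proof.
move=> cg; have mSk : measurable_fun setT (S k).
  exact: (measurableT_comp (mS (ltnW kn)) (mid_P (s_le1 (ltnW kn)))).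
have mSk1 : measurable_fun setT (S k.+1).
  exact: (measurableT_comp (mS kn) (mid_P (s_le1 kn))).
have VE : V k.+1 = fun w => V k w + v w by apply/funext => w; rewrite V_step.
apply: (cond_gaussian_ae mid_Z _ mSk1 S_step).
  exact: measurable_funD.
rewrite VE.
exact: (@cond_gaussian_chain _ _ _ T UZ (UP (s k)) R P id id id (@mid_PZ (s k))
  (fun=> erefl) _ _ _ _ (mS (ltnW kn)) (@mV k) mv (V_ge0 k) v_ge0 cg D_gaussian).
Qed.

End Step.

Let cond_gaussian_S k : (k <= n)%N -> cond_gaussian P (id : T -> UZ) (S k) (V k).
Proof.
elim: k => [_|k IH kn]; last by apply: cond_gaussian_step => //; exact/IH/ltnW.
have mS0 : measurable_fun setT (S 0%N).
  exact: (measurableT_comp (mS (leq0n n)) (mid_P (s_le1 (leq0n n)))).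
have [B0 _ _] := snake_path hW (s_01 (leq0n n)).
(* The lifetime at time 0 is 0, so every later path splits from the initial one at height 0 and
   nothing is visible yet. *)
have S0 : {ae P, forall w, cst 0 w = S 0%N w}.
  apply: filterS B0 => w B0; rewrite /S big1// => j _.
  by rewrite ltn0 C0 ?leq_ord// B0 mulr0.
apply: (cond_gaussian_ae mid_Z _ mS0 S0) => // h kh.
apply: eq_integral => w _.
have -> : V 0%N w = 0.
  rewrite /V big1// => i _; rewrite big1// => j _.
  by rewrite minn0 C0 ?mulr0// geq_max !leq_ord.
rewrite sqrtr0; under eq_integral do rewrite mul0r.
by rewrite (integral_probability_cst (normal_prob 0 1)).
Qed.

(** At the last step every head is visible; the remaining index [j = n] is read at height [C n n],
    the full lifetime. *)
Let SE w : S n w = \sum_(j < n.+1) n.+1%:R^-1 * snake_head zeta W (j%:R / n.+1%:R) w.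
Proof.
apply: eq_bigr => -[j jn] _ /=; congr (_ * _); case: ltnP => // nj.
have -> : j = n by apply/eqP; rewrite eqn_leq nj -ltnS jn.
by rewrite C_id.
Qed.

Let VE w : V n w = \sum_(i < n.+1) \sum_(j < n.+1) n.+1%:R^-1 * n.+1%:R^-1 *
   path_min zeta ((minn i j)%:R / n.+1%:R) ((maxn i j)%:R / n.+1%:R) w.
Proof.
apply: eq_bigr => i _; apply: eq_bigr => j _; congr (_ * C _ _ w).
by rewrite (minn_idPl _)// (leq_trans (geq_minl _ _))// leq_ord.
Qed.

Lemma snake_head_riemann_gaussian :
  let X w := \sum_(j < n.+1) n.+1%:R^-1 * snake_head zeta W (j%:R / n.+1%:R) w in
  let Q w := \sum_(i < n.+1) \sum_(j < n.+1) n.+1%:R^-1 * n.+1%:R^-1 *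
    path_min zeta ((minn i j)%:R / n.+1%:R) ((maxn i j)%:R / n.+1%:R) w in
  [/\ measurable_fun setT X, measurable_fun setT (Q : UZ -> R) &
      cond_gaussian P (id : T -> UZ) X Q].
Proof.
move=> X Q; have -> : X = S n by apply/funext => w; rewrite SE.
have -> : Q = V n by apply/funext => w; rewrite VE.
split; [|exact: mV|exact: cond_gaussian_S].
exact: (measurableT_comp (mS (leqnn n)) (mid_P (s_le1 (leqnn n)))).
Qed.

End Discrete.
End Snake.

(** * Riemann sums *)

Lemma integral_step d (T : measurableType d) (R : realType)
    (m : {measure set T -> \bar R}) (D : set T) (I : finType) (c : I -> R)
    (A : I -> set T) : measurable D -> (m D < +oo)%E ->
  (forall i, measurable (A i)) -> (forall i, A i `<=` D) ->
  (\int[m]_(x in D) (\sum_i c i * \1_(A i) x)%:E = \sum_i (c i)%:E * m (A i))%E.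
Proof.
move=> mD finD mA AD.
have int1 i : m.-integrable D (fun x => (\1_(A i) x)%:E).
  apply: measurable_bounded_integrable => //.
  exists 1; split => // x x1 y _ /=; apply: le_trans (ltW x1).
  by rewrite ger0_norm// indicE lern1 leq_b1.
under eq_integral do rewrite -sumEFin.
rewrite (@integral_sum _ _ _ m D mD _ (fun i x => (c i * \1_(A i) x)%:E)); last first.
  by move=> i; under eq_fun do rewrite EFinM; exact: integrableZl.
apply: eq_bigr => i _; under eq_integral do rewrite EFinM.
by rewrite integralZl// integral_indic// (setIidl (AD i)).
Qed.

Lemma cvg_integral_bounded d (T : measurableType d) (R : realType)
    (m : {measure set T -> \bar R}) (D : set T) (f_ : nat -> T -> R) (f : T -> R)
    (M : R) : measurable D -> (m D < +oo)%E ->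
  (forall n, measurable_fun D (f_ n)) ->
  (forall n x, D x -> `|f_ n x| <= M) ->
  (forall x, D x -> f_ ^~ x @ \oo --> f x) ->
  m.-integrable D (EFin \o f) /\
  (\int[m]_(x in D) f_ n x @[n --> \oo] --> \int[m]_(x in D) f x).
Proof.
move=> mD finD mf fM ff.
have M0 x : D x -> 0 <= M by move=> Dx; exact: le_trans (normr_ge0 _) (fM 0%N x Dx).
have intM : m.-integrable D (cst M%:E).
  by apply: (@measurable_bounded_integrable _ _ _ m (cst M)) => //; exact: bounded_cst.
have mlim : measurable_fun D f by exact: measurable_fun_cvg mf ff.
have mfE n : measurable_fun D (EFin \o f_ n) by exact/measurable_EFinP.
have mlimE : measurable_fun D (EFin \o f) by exact/measurable_EFinP.
have ffE : {ae m, forall x, D x -> (EFin \o f_ n) x @[n --> \oo] --> (EFin \o f) x}.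
  by apply: aeW => x Dx; apply: cvg_EFin; [near=> n|exact: ff].
have fME : {ae m, forall x n, D x -> (`|(EFin \o f_ n) x| <= cst M%:E x)%E}.
  by apply: aeW => x n Dx; rewrite lee_fin; exact: fM.
have [intf _ cint] := dominated_convergence mD mfE mlimE ffE intM fME.
split => //; apply: fine_cvg; rewrite fineK//.
exact: integrable_fin_num.
Unshelve. all: by end_near. Qed.

Lemma within_continuous_bounded (R : realType) (f : R -> R) :
  {within `[0, 1], continuous f} -> exists M, forall x, 0 <= x <= 1 -> `|f x| <= M.
Proof.
move=> cf; have /compact_bounded[M [_ /(_ (M + 1))]] :=
  continuous_compact cf (@segment_compact R 0 1).
move=> H; exists (M + 1) => x x01; apply: H; first by rewrite ltrDl.
by exists x => //=; rewrite in_itv.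
Qed.

Section RiemannSums.
Context {R : realType}.
Local Notation mu := (@lebesgue_measure R).

Let q n (x : R) := Num.truncn (x / n.+1%:R^-1).

(* The last cell, with [j = n.+1], is the null set [[set 1]]. *)
Let cell n j : set R := `[0, 1] `&` (q n @^-1` [set j]).

Let cell_measurable n j : measurable (cell n j).
Proof.
apply: measurableI => //; apply: (@measurable_truncn _ _ _ (fun x : R => x / _)).
exact: measurable_funM.
Qed.

Let cell_sub n j : cell n j `<=` `[0, 1].
Proof. by move=> x []. Qed.

Let q_eq n x j : 0 <= x ->
  (q n x == j) = (j%:R / n.+1%:R <= x < j.+1%:R / n.+1%:R).
Proof.
move=> x0; rewrite /q invrK truncn_eq ?mulr_ge0//.
by rewrite ler_pdivrMr// ltr_pdivlMr.
Qed.

Let q_lt n x : 0 <= x <= 1 -> (q n x < n.+2)%N.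
Proof.
move=> /andP[x0 x1]; rewrite /q invrK truncn_lt_nat ?mulr_ge0//.
by rewrite (@le_lt_trans _ _ n.+1%:R) ?ltr_nat// ler_piMl.
Qed.

Let grid_q n x : grid n.+1%:R^-1 x = (q n x)%:R / n.+1%:R.
Proof. by rewrite mulrC. Qed.

Let mu_cell n j : (j <= n.+1)%N ->
  mu (cell n j) = (if (j <= n)%N then n.+1%:R^-1 else 0)%:E.
Proof.
have n0 : 0 < n.+1%:R :> R by [].
move=> jn1; case: leqP => jn.
  rewrite (_ : cell n j = `[j%:R / n.+1%:R, j.+1%:R / n.+1%:R[%classic).
    rewrite lebesgue_measure_itv/= lte_fin ltr_pM2r ?invr_gt0// ltr_nat ltnSn.
    by rewrite -EFinB -mulrBl -natrB// subSnn mul1r.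
  apply/seteqP; split => x /=; rewrite !in_itv/=.
    by move=> [/andP[x0 _] /eqP]; rewrite q_eq.
  move=> /andP[jx xj]; have x0 : 0 <= x by apply: le_trans jx; rewrite divr_ge0.
  split; last by apply/eqP; rewrite q_eq// jx.
  rewrite /= in_itv/= x0/= (le_trans (ltW xj))// ler_pdivrMr// mul1r ler_nat.
  by rewrite ltnS.
have -> : j = n.+1 by apply/eqP; rewrite eqn_leq jn1.
rewrite (_ : cell n n.+1 = [set 1]) ?lebesgue_measure_set1//.
apply/seteqP; split => [x [] /=|x ->]; first rewrite in_itv/=.
  move=> /andP[x0 x1] /eqP; rewrite q_eq// divff ?gt_eqF// => /andP[x1' _].
  by apply/eqP; rewrite eq_le x1.
split; first by rewrite /= in_itv/= ler01 lexx.
apply/eqP; rewrite q_eq//.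
by rewrite divff ?gt_eqF// lexx/= ltr_pdivlMr// mul1r ltr_nat.
Qed.

Let sum_cell n (c : nat -> R) x : 0 <= x <= 1 ->
  \sum_(j < n.+2) c j * \1_(cell n j) x = c (q n x).
Proof.
move=> x01; rewrite (bigD1 (Ordinal (q_lt n x01)))//= big1 ?addr0.
  by rewrite indicE mem_set ?mulr1// /cell; split => //=; rewrite in_itv.
move=> i iq; rewrite indicE memNset ?mulr0// => -[_ /= qi].
by case/eqP: iq; apply/val_inj; rewrite /= -qi.
Qed.

(** The sum is the integral of the step function equal to [f] at the left endpoint of each cell,
    which is uniformly bounded and converges pointwise to [f]. *)
Lemma riemann_sum_cvg (f : R -> R) : {within `[0, 1], continuous f} ->
  mu.-integrable `[0, 1] (EFin \o f) /\
  (\sum_(j < n.+1) n.+1%:R^-1 * f (j%:R / n.+1%:R) @[n --> \oo] -->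
   \int[mu]_(x in `[0, 1]) f x).
Proof.
move=> cf.
have [M fM] := within_continuous_bounded cf.
pose I01 : set R := `[0, 1]%classic.
have mI01 : measurable I01 by exact: measurable_itv.
have finD : (mu I01 < +oo)%E.
  by rewrite lebesgue_measure_itv/= lte01 ltry.
pose g n x := \sum_(j < n.+2) f (j%:R / n.+1%:R) * \1_(cell n j) x.
have gE n x : 0 <= x <= 1 -> g n x = f (grid n.+1%:R^-1 x).
  by move=> x01; rewrite /g (sum_cell n (fun j => f (j%:R / n.+1%:R)) x01) grid_q.
have grid01 n (x : R) : 0 <= x <= 1 -> 0 <= grid n.+1%:R^-1 x <= 1.
  by move=> /andP[x0 x1]; rewrite grid_ge0//= (le_trans _ x1)// grid_le.
have mg n : measurable_fun I01 (g n).
  by apply: measurable_funTS; apply: measurable_sum => j; exact: measurable_funM.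
have gM n x : I01 x -> `|g n x| <= M.
  by rewrite /I01 /= in_itv/= => x01; rewrite gE//; apply/fM/grid01.
have gf x : I01 x -> g ^~ x @ \oo --> f x.
  move=> xI; have x01 : 0 <= x <= 1 by move: xI; rewrite /I01 /= in_itv.
  rewrite (_ : g ^~ x = fun n => f (grid n.+1%:R^-1 x)); last first.
    by apply/funext => n; exact: gE.
  apply: (within_continuous_cvg (x_ := fun n => grid n.+1%:R^-1 x) cf) => //.
  - by move=> n; rewrite /= in_itv/=; exact: grid01.
  - by apply: grid_cvg; case/andP: x01.
have [intf cint] := @cvg_integral_bounded _ _ R mu I01 g f M mI01 finD mg gM gf.
split; first exact: intf.
have gint n : \sum_(j < n.+1) n.+1%:R^-1 * f (j%:R / n.+1%:R) =
    \int[mu]_(x in `[0, 1]) g n x.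
  rewrite /Rintegral integral_step//; last by move=> i; exact: cell_measurable.
  suff -> : (\sum_(i < n.+2) (f (i%:R / n.+1%:R))%:E * mu (cell n i) =
     (\sum_(j < n.+1) n.+1%:R^-1 * f (j%:R / n.+1%:R))%:E)%E by [].
  rewrite big_ord_recr/= (mu_cell (leqnn n.+1)) ltnn mule0 adde0 -sumEFin.
  apply: eq_bigr => i _; rewrite mu_cell; last exact/ltnW/ltn_ord.
  by rewrite leq_ord -EFinM mulrC.
by rewrite (funext gint).
Qed.

Let triangle : set (R * R) := [set p | [/\ 0 <= p.1, p.1 < p.2 & p.2 <= 1]].

(** The sum is the integral over the unit square of a step function that vanishes unless the cell of
    [s] strictly precedes that of [t]. Its pointwise limit is [F] on the triangle and 0 elsewhere,
    diagonal included, and dominated convergence concludes. *)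
Lemma riemann_sum_triangle_cvg (F : R -> R -> R) (M : R) :
  (forall s t, 0 <= s -> s <= t -> t <= 1 -> `|F s t| <= M) ->
  (forall s t, 0 <= s -> s < t -> t <= 1 ->
    F (grid n.+1%:R^-1 s) (grid n.+1%:R^-1 t) @[n --> \oo] --> F s t) ->
  (\sum_(i < n.+1) \sum_(j < n.+1) n.+1%:R^-1 * n.+1%:R^-1 *
     (if (i < j)%N then F (i%:R / n.+1%:R) (j%:R / n.+1%:R) else 0))
   @[n --> \oo] -->
  \int[(mu \x mu)%E]_(p in triangle) F p.1 p.2.
Proof.
move=> FM FF.
pose D : set (R * R) := `[0, 1] `*` `[0, 1].
have mD : measurable D by exact: measurableX.
have mu01 : mu `[0%R, 1%R]%classic = 1%E.
  by rewrite lebesgue_measure_itv/= lte01 oppr0 adde0.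
have finD : ((mu \x mu)%E D < +oo)%E.
  have E : ((mu \x mu) D = mu `[0%R, 1%R]%classic * mu `[0%R, 1%R]%classic)%E.
    by apply: product_measure1E; exact: measurable_itv.
  by rewrite E mu01 mule1 ltry.
have DP p : D p -> 0 <= p.1 <= 1 /\ 0 <= p.2 <= 1.
  by move=> [/=]; rewrite !in_itv.
pose G n i j : R := if (i < j)%N then F (i%:R / n.+1%:R) (j%:R / n.+1%:R) else 0.
pose c n (ij : 'I_n.+2 * 'I_n.+2) := G n ij.1 ij.2.
pose A n (ij : 'I_n.+2 * 'I_n.+2) := cell n ij.1 `*` cell n ij.2.
pose g n p := \sum_ij c n ij * \1_(A n ij) p.
have mA n ij : measurable (A n ij) by apply: measurableX.
have gE n p : D p -> g n p = G n (q n p.1) (q n p.2).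
  move=> /DP[p1 p2]; rewrite /g -(pair_bigA _ (fun i j => c n (i, j) * \1_(A n (i, j)) p)) /=.
  rewrite -(@sum_cell n (fun i => G n i (q n p.2)) _ p1); apply: eq_bigr => i _.
  rewrite -(@sum_cell n (fun j => G n i j) _ p2) mulr_suml; apply: eq_bigr => j _.
  rewrite /c /= -mulrA; congr (_ * _).
  by rewrite mulrC /A !indicE in_setX -natrM mulnb.
have q_le n s t : s <= t -> 0 <= s -> (q n s <= q n t)%N.
  move=> st s0; rewrite /q invrK truncn_ge_nat ?mulr_ge0 ?(le_trans s0 st)//.
  apply: (@le_trans _ _ (s * n.+1%:R)); last by rewrite ler_pM2r.
  by rewrite truncn_le mulr_ge0.
have mg n : measurable_fun D (g n).
  by apply: measurable_funTS; apply: measurable_sum => j; exact: measurable_funM.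
have grid01 n (x : R) : 0 <= x <= 1 -> 0 <= grid n.+1%:R^-1 x <= 1.
  by move=> /andP[x0 x1]; rewrite grid_ge0//= (le_trans _ x1)// grid_le.
have M0 : 0 <= M by apply: le_trans (FM 0 0 _ _ _).
have gM n p : D p -> `|g n p| <= M.
  move=> Dp; rewrite gE// /G; case: ifP => [qq|]; last by rewrite normr0.
  have [p1 p2] := DP _ Dp.
  rewrite -!grid_q; have /andP[a0 a1] := grid01 n _ p1; have /andP[b0 b1] := grid01 n _ p2.
  by apply: FM => //; rewrite !grid_q ler_pM2r// ler_nat ltnW.
pose f p := if p.1 < p.2 then F p.1 p.2 else 0.
have gf p : D p -> g ^~ p @ \oo --> f p.
  move=> Dp; have [p1 p2] := DP _ Dp; have /andP[p10 p11] := p1; have /andP[p20 p21] := p2.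
  rewrite (_ : g ^~ p = fun n => G n (q n p.1) (q n p.2)); last first.
    by apply/funext => n; exact: gE.
  rewrite /f /G; case: ltP => pp; last first.
    rewrite (_ : (fun n => _) = cst 0); first exact: cvg_cst.
    by apply/funext => n; rewrite ltnNge q_le.
  have FFp := FF _ _ p10 pp p21.
  apply: cvg_trans FFp; apply: near_eq_cvg.
  (* Once the mesh is fine enough, the two coordinates lie in distinct cells and the step function
     takes the value of [F] at the rounded points. *)
  have cd : grid n.+1%:R^-1 p.2 - grid n.+1%:R^-1 p.1 @[n --> \oo] --> p.2 - p.1.
    by apply: cvgB; exact: grid_cvg.
  have pp0 : 0 < p.2 - p.1 by rewrite subr_gt0.
  have /cvgr_gt/(_ _ pp0)[N _ NX] := cd; exists N => // n Nn.
  have := NX n Nn; rewrite /= subr_gt0 !grid_q ltr_pM2r// ltr_nat => ->.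
  by [].
have [intf cint] := @cvg_integral_bounded _ _ R (mu \x mu)%E D g f M mD finD mg gM gf.
have -> : \int[(mu \x mu)%E]_(p in triangle) F p.1 p.2 =
    \int[(mu \x mu)%E]_(p in D) f p.
  rewrite Rintegral_mkcond [RHS]Rintegral_mkcond; apply: eq_Rintegral => p _.
  rewrite !patchE; case: ifPn => [|pt]; rewrite ?inE.
    move=> [p0 pp p1]; rewrite mem_set; last first.
      by split; rewrite /= in_itv/= ?p0 ?p1 ?(ltW (lt_le_trans pp p1)) ?(ltW (le_lt_trans p0 pp)).
    by rewrite /f pp.
  case: ifPn => //; rewrite inE => /DP[/andP[p10 p11] /andP[p20 p21]].
  rewrite /f; case: ltP => // pp; move: pt; rewrite notin_setE => pt.
  by exfalso; apply: pt; split.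
have gint n : \sum_(i < n.+1) \sum_(j < n.+1) n.+1%:R^-1 * n.+1%:R^-1 * G n i j =
    \int[(mu \x mu)%E]_(p in D) g n p.
  rewrite /Rintegral integral_step//; last 2 first.
  - by move=> ij; exact: mA.
  - by move=> ij p [] [h1 _] [h2 _]; split.
  have muA (i j : 'I_n.+2) : ((mu \x mu)%E (A n (i, j)) =
      ((if (i <= n)%N then n.+1%:R^-1 else 0) *
       (if (j <= n)%N then n.+1%:R^-1 else 0))%:E)%E.
    have E : ((mu \x mu) (A n (i, j)) = mu (cell n i) * mu (cell n j))%E.
      by apply: product_measure1E; exact: cell_measurable.
    by rewrite E EFinM; congr (_ * _)%E; exact: (mu_cell (leq_ord _)).
  suff -> : (\sum_(ij : 'I_n.+2 * 'I_n.+2) (c n ij)%:E * (mu \x mu) (A n ij) =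
     (\sum_(i < n.+1) \sum_(j < n.+1) n.+1%:R^-1 * n.+1%:R^-1 * G n i j)%:E)%E by [].
  rewrite -(pair_bigA _ (fun i j => (c n (i, j))%:E * (mu \x mu)%E (A n (i, j)))%E)/=.
  rewrite big_ord_recr/= [X in (_ + X)%E]big1 ?adde0; last first.
    by move=> j _; rewrite muA /= ltnn mul0r mule0.
  rewrite -sumEFin; apply: eq_bigr => i _.
  rewrite big_ord_recr/= muA/= ltnn mulr0 mule0 adde0.
  rewrite -sumEFin; apply: eq_bigr => j _.
  by rewrite muA/= !leq_ord -EFinM mulrC.
by rewrite (funext gint).
Qed.

End RiemannSums.

(** * Convergence of the path minima and identification of the limits *)

Lemma within_continuous_delta (R : realType) (A : set R) (f : R -> R) (x eps : R) :
  {within A, continuous f} -> A x -> 0 < eps ->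
  exists2 del, 0 < del & forall u, A u -> `|x - u| < del -> `|f x - f u| < eps.
Proof.
move=> /subspace_continuousP cf Ax eps0.
have /cvgrPdist_lt/(_ _ eps0)[del /= del0 H] := cf x Ax.
by exists del => // u Au xu; exact: H.
Qed.

Section PathMinLimits.
Context d (T : measurableType d) (R : realType).
Variable X : R -> T -> R.
Hypothesis X0 : forall t w, 0 <= t <= 1 -> 0 <= X t w.
Hypothesis cX : forall w, {within `[0, 1], continuous (X ^~ w)}.

Lemma path_min_scale (c s t : R) w : 0 < c -> 0 <= s -> s <= t -> t <= 1 ->
  path_min (fun s w => c * X s w) s t w = c * path_min X s t w.
Proof.
move=> c0 s0 st t1.
have cX0 r v : 0 <= r <= 1 -> 0 <= c * X r v.
  by move=> r01; rewrite mulr_ge0 ?X0// ltW.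
apply/eqP; rewrite eq_le; apply/andP; split; last first.
  by apply: path_min_ge => // u sut; rewrite ler_pM2l// path_min_le.
rewrite mulrC -ler_pdivrMr//; apply: path_min_ge => // u sut.
by rewrite ler_pdivrMr// mulrC (path_min_le cX0).
Qed.

(** The intervals before and after rounding share [[s, tn]], which is not empty for large [n]
    because [s < t]. They differ by the short pieces [[sn, s]] and [[tn, t]], on which the path
    stays close to its values at [s] and [t]. *)
Lemma path_min_grid_cvg s t w : 0 <= s -> s < t -> t <= 1 ->
  path_min X (grid n.+1%:R^-1 s) (grid n.+1%:R^-1 t) w @[n --> \oo] -->
  path_min X s t w.
Proof.
move=> s0 st t1; have t0 := le_trans s0 (ltW st); have s1 := le_trans (ltW st) t1.
apply/cvgrPdist_le => eps eps0.
have e2 : 0 < eps / 2 by rewrite divr_gt0.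
have Is : `[0, 1]%classic s by rewrite /= in_itv/= s0 s1.
have It : `[0, 1]%classic t by rewrite /= in_itv/= t0 t1.
have [ds ds0 Hs] := within_continuous_delta (@cX w) Is e2.
have [dt dt0 Ht] := within_continuous_delta (@cX w) It e2.
have gs : grid n.+1%:R^-1 s @[n --> \oo] --> s by exact: grid_cvg.
have gt : grid n.+1%:R^-1 t @[n --> \oo] --> t by exact: grid_cvg.
have /cvgrPdist_lt/(_ _ ds0) near_s := gs.
have /cvgrPdist_lt/(_ _ dt0) near_t := gt.
have /cvgr_gt/(_ _ st) near_st := gt.
near=> n.
have stn : s < grid n.+1%:R^-1 t by near: n; exact: near_st.
have dsn : `|s - grid n.+1%:R^-1 s| < ds by near: n; exact: near_s.
have dtn : `|t - grid n.+1%:R^-1 t| < dt by near: n; exact: near_t.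
move: stn dsn dtn; set sn := grid _ s; set tn := grid _ t => stn dsn dtn.
have sn0 : 0 <= sn by exact: grid_ge0.
have sns : sn <= s by exact: grid_le.
have tnt : tn <= t by exact: grid_le.
rewrite ger0_norm ?subr_ge0// in dsn; rewrite ger0_norm ?subr_ge0// in dtn.
have tn1 := le_trans tnt t1.
have tn0 := le_trans s0 (ltW stn).
have Xs u : sn <= u <= s -> `|X s w - X u w| < eps / 2.
  move=> /andP[snu us]; apply: Hs.
    by rewrite /= in_itv/= (le_trans sn0 snu) (le_trans us).
  by rewrite ger0_norm ?subr_ge0//; apply: le_lt_trans dsn; rewrite lerD2l lerN2.
have Xt u : tn <= u <= t -> `|X t w - X u w| < eps / 2.
  move=> /andP[tnu ut]; apply: Ht.
    by rewrite /= in_itv/= (le_trans tn0 tnu) (le_trans ut).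
  by rewrite ger0_norm ?subr_ge0//; apply: le_lt_trans dtn; rewrite lerD2l lerN2.
have m1 : X s w - eps / 2 <= path_min X sn s w.
  apply: path_min_ge => // u /Xs /ltW; rewrite ler_norml => /andP[_ h]; lra.
have m2 : X t w - eps / 2 <= path_min X tn t w.
  apply: path_min_ge => // u /Xt /ltW; rewrite ler_norml => /andP[_ h]; lra.
have m3 : `|X t w - X tn w| < eps / 2 by apply: Xt; rewrite lexx.
(* Adding [[sn, s]] lowers the minimum by at most [eps / 2]. For [[tn, t]] the comparison passes
   from the piece to [X t w] and then to [X tn w], at a cost of [eps / 2] each time. *)
have E1 := path_min_split X0 w sn0 sns (ltW stn) tn1.
have E2 := path_min_split X0 w s0 (ltW stn) tnt t1.
have p1 : path_min X s t w <= X s w by apply: path_min_le => //; rewrite lexx ltW.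
have p2 : path_min X sn tn w <= X tn w.
  by apply: path_min_le => //; rewrite lexx (le_trans sns)// ltW.
rewrite ltr_norml in m3; case/andP: m3 => m3 m4.
move: E1 E2; rewrite /Num.min; case: ltP => h1; case: ltP => h2 E1 E2;
  rewrite ler_norml; apply/andP; split; lra.
Unshelve. all: by end_near. Qed.

End PathMinLimits.

(** [is_ISE] speaks of nonnegative functions only, so the positive and negative parts of the
    identity are treated separately. *)
Lemma integral_head_center_of_mass d (T : measurableType d) (R : realType)
    (zeta : R -> T -> R) (W : R -> R -> T -> R) (J : T -> probability R R) w :
  is_ISE zeta W J ->
  center_of_mass J w = \int[@lebesgue_measure R]_(s in `[0, 1]) snake_head zeta W s w.
Proof.
move=> hJ; rewrite /center_of_mass /Rintegral; congr fine.
rewrite integralE [RHS]integralE; congr (_ - _)%E.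
- have := hJ w (fun x => Num.max x 0) _ _.
  rewrite (_ : (fun x : R => x%:E)^\+%E = fun x : R => (Num.max x 0)%:E).
    move=> ->.
    + by apply: eq_integral => s _; rewrite funeposE -EFin_max.
    + exact: measurable_maxr.
    + by move=> x; rewrite le_max lexx orbT.
  by apply/funext => x; rewrite funeposE -EFin_max.
- have := hJ w (fun x => Num.max (- x) 0) _ _.
  rewrite (_ : (fun x : R => x%:E)^\-%E = fun x : R => (Num.max (- x) 0)%:E).
    move=> ->.
    + by apply: eq_integral => s _; rewrite funenegE -EFinN -EFin_max.
    + apply: measurable_maxr => //; exact: measurableT_comp.
    + by move=> x; rewrite le_max lexx orbT.
  by apply/funext => x; rewrite funenegE -EFinN -EFin_max.
Qed.

Lemma sum_symmetric (R : realType) n (h : nat -> nat -> R) :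
  \sum_(i < n) \sum_(j < n) h (minn i j) (maxn i j) =
  2 * \sum_(i < n) \sum_(j < n) (if (i < j)%N then h i j else 0) +
  \sum_(i < n) h i i.
Proof.
transitivity (\sum_(i < n) \sum_(j < n) ((if (i < j)%N then h i j else 0) +
   (if (j < i)%N then h j i else 0) + (if i == j :> nat then h i i else 0))).
  apply: eq_bigr => i _; apply: eq_bigr => j _.
  case: (ltngtP i j) => [ij|ij|->]; by rewrite ?addr0 ?add0r.
under eq_bigr do rewrite 2!big_split/=.
rewrite 2!big_split/= mulr2n mulrDl !mul1r; congr (_ + _ + _).
  exact: exchange_big.
apply: eq_bigr => i _; rewrite (bigD1 i)//= eqxx big1 ?addr0// => j ji.
by rewrite eq_sym ifN.
Qed.

(** The constant 4 is a factor 2 from the lifetime [2 * e] times a factor 2 from the symmetry of the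
    double sum. The diagonal is [n.+1%:R^-1] times a convergent Riemann sum, hence vanishes in the
    limit. *)
Lemma excursion_eta_riemann d (T : measurableType d) (R : realType)
    (e : R -> T -> R) w :
  (forall t w, 0 <= t <= 1 -> 0 <= e t w) ->
  (forall w, {within `[0, 1], continuous (e ^~ w)}) ->
  (\sum_(i < n.+1) \sum_(j < n.+1) n.+1%:R^-1 * n.+1%:R^-1 *
    path_min (fun s w => 2 * e s w) ((minn i j)%:R / n.+1%:R)
      ((maxn i j)%:R / n.+1%:R) w) @[n --> \oo] --> excursion_eta e w.
Proof.
move=> e0 ce; have [M eM] := within_continuous_bounded (@ce w).
pose Tr n := \sum_(i < n.+1) \sum_(j < n.+1) n.+1%:R^-1 * n.+1%:R^-1 *
  (if (i < j)%N then path_min e (i%:R / n.+1%:R) (j%:R / n.+1%:R) w else 0).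
pose Dg n := \sum_(i < n.+1) n.+1%:R^-1 * e (i%:R / n.+1%:R) w.
have E n : \sum_(i < n.+1) \sum_(j < n.+1) n.+1%:R^-1 * n.+1%:R^-1 *
    path_min (fun s w => 2 * e s w) ((minn i j)%:R / n.+1%:R)
      ((maxn i j)%:R / n.+1%:R) w = 4 * Tr n + n.+1%:R^-1 * (2 * Dg n).
  have frac i j : (i <= j)%N -> (j <= n)%N -> [/\ (0 : R) <= i%:R / n.+1%:R,
      (i%:R / n.+1%:R : R) <= j%:R / n.+1%:R & (j%:R / n.+1%:R : R) <= 1].
    move=> ij jn; split; first by rewrite divr_ge0.
      by rewrite ler_pM2r ?invr_gt0// ler_nat.
    by rewrite ler_pdivrMr// mul1r ler_nat ltnW.
  rewrite (sum_symmetric _ (fun i j => n.+1%:R^-1 * n.+1%:R^-1 *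
    path_min (fun s w => 2 * e s w) (i%:R / n.+1%:R) (j%:R / n.+1%:R) w)).
  congr (_ + _).
    rewrite /Tr !mulr_sumr; apply: eq_bigr => i _.
    rewrite !mulr_sumr; apply: eq_bigr => j _.
    case: ifPn => [ij|_]; last by rewrite !mulr0.
    have [h1 h2 h3] := frac i j (ltnW ij) (leq_ord j).
    by rewrite path_min_scale//; ring.
  rewrite /Dg !mulr_sumr; apply: eq_bigr => i _.
  have [h1 h2 h3] := frac i i (leqnn i) (leq_ord i).
  rewrite path_min_scale// path_min_id//; first by ring.
  by rewrite h1.
rewrite (funext E) -[X in _ --> X]addr0; apply: cvgD.
  apply: cvgM; first exact: cvg_cst.
  apply: (riemann_sum_triangle_cvg (F := fun s t => path_min e s t w) (M := M)).
    move=> s t s0 st t1; rewrite ger0_norm ?path_min_ge0//.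
    apply: le_trans (path_min_le e0 w s0 t1 (_ : s <= s <= t)) _.
      by rewrite lexx.
    by apply: le_trans (ler_norm _) (eM _ _); rewrite s0 (le_trans st).
  by move=> s t s0 st t1; exact: path_min_grid_cvg.
have [_ cD] := riemann_sum_cvg (@ce w).
rewrite -[X in _ --> X](mul0r (2 * \int[@lebesgue_measure R]_(x in `[0, 1]) e x w)).
apply: cvgM; first exact: cvg_harmonic.
by apply: cvgM; [exact: cvg_cst|exact: cD].
Qed.

(** * From test functions to equality in law *)

Lemma same_distribution_test d (T : measurableType d) (R : realType)
    (P : probability T R) (X Y : T -> R) :
  measurable_fun setT X -> measurable_fun setT Y ->
  (forall f : R -> R, continuous f -> (forall x, 0 <= f x <= 1) ->
    (\int[P]_w (f (X w))%:E = \int[P]_w (f (Y w))%:E)%E) ->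
  same_distribution P X Y.
Proof.
move=> mX mY XY; split => //.
(* These continuous ramps converge to the indicator of the open ray below [a]; such rays are stable
   under intersection and generate the Borel sets. *)
pose f a n (x : R) : R := Num.min 1 (Num.max 0 (n%:R * (a - x))).
have cf a n : continuous (f a n).
  move=> x; apply: (@continuous_min _ R (cst 1)
    (fun x => Num.max 0 (n%:R * (a - x)))); first exact: cvg_cst.
  apply: (@continuous_max _ R (cst 0) (fun x => n%:R * (a - x))); first exact: cvg_cst.
  apply: cvgM; first exact: cvg_cst.
  by apply: cvgB; [exact: cvg_cst|exact: cvg_id].
have f01 a n x : 0 <= f a n x <= 1.
  by rewrite /f le_min ler01 le_max lexx ge_min lexx.
have mf a n : measurable_fun setT (f a n) by exact: continuous_measurable_fun.
have fcvg a x : f a n x @[n --> \oo] --> (\1_(`]-oo, a[%classic) x : R).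
  have [xa|ax] := ltP x a.
    rewrite indicE mem_set /=; last by rewrite in_itv.
    apply: cvg_near_cst; exists (Num.truncn (a - x)^-1).+1 => // n /= nx.
    rewrite /f min_l// le_max; apply/orP; right.
    rewrite mulrC -ler_pdivrMl ?subr_gt0// mulr1 ltW// (lt_le_trans (truncnS_gt _))//.
    by rewrite ler_nat.
  rewrite indicE memNset /=; last by rewrite in_itv/= ltNge ax.
  rewrite (_ : (fun n => _) = cst 0); first exact: cvg_cst.
  apply/funext => n; rewrite /f max_l ?min_r//.
  by rewrite mulr_ge0_le0// subr_le0.
have lim_ray Z a : measurable_fun setT Z ->
    (\int[P]_w (f a n (Z w))%:E)%E @[n --> \oo] --> P (Z @^-1` `]-oo, a[%classic).
  move=> mZ; have mray := measurable_preimage mZ (measurable_itv `]-oo, a[).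
  have -> : (P (Z @^-1` `]-oo, a[%classic) =
      \int[P]_w (\1_(`]-oo, a[%classic) (Z w))%:E)%E.
    by rewrite -[in LHS](setIT (Z @^-1` _)) -integral_indic.
  apply: cvg_integral_unit => [n|n w|w].
  - by apply/measurable_EFinP; exact: measurableT_comp.
  - by rewrite !lee_fin.
  - by apply: cvg_EFin; [near=> n|exact: fcvg].
have ray a : P (X @^-1` `]-oo, a[%classic) = P (Y @^-1` `]-oo, a[%classic).
  have cX := lim_ray X a mX; have cY := lim_ray Y a mY.
  rewrite (funext (fun n => XY (f a n) (cf a n) (f01 a n))) in cX.
  exact: cvg_unique cX cY.
move=> A mA; change (image_measure P mX A = image_measure P mY A).
pose g (n : nat) : set R := `]-oo, n%:R[%classic.
have mG : (@measurable _ (measurableTypeR R)) = <<s @RGenInftyO.G R >>.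
  by rewrite RGenInftyO.measurableE.
have GI : setI_closed (@RGenInftyO.G R).
  move=> _ _ [a ->] [b ->]; exists (Num.min a b).
  apply/seteqP; split => x /=; rewrite !in_itv/= lt_min; first by move=> [-> ->].
  by move=> /andP[].
have Gg n : @RGenInftyO.G R (g n) by exists n%:R.
have gT : \bigcup_k g k = setT.
  apply/seteqP; split => // x _; exists (Num.truncn x).+1 => //=.
  by rewrite /g /= in_itv/= truncnS_gt.
apply: (measure_unique (@RGenInftyO.G R) g mG GI Gg gT (image_measure P mX)
  (image_measure P mY)) => //; first by move=> _ [a ->]; exact: ray.
move=> n; apply: le_lt_trans (ltry 1%R); apply: probability_le1.
by apply: (measurable_preimage mX); exact: measurable_itv.
Unshelve. all: by end_near. Qed.

Theorem theorem3p1 (R : realType) (d : measure_display) (T : measurableType d)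
    (P : probability T R) (e : R -> T -> R) (W : R -> R -> T -> R)
    (J : T -> probability R R) (N : {RV P >-> R})
    (he : brownian_excursion P e)
    (hW : brownian_snake P (fun s w => 2 * e s w) W)
    (hJ : is_ISE (fun s w => 2 * e s w) W J)
    (hN : standard_gaussian P N)
    (hind : independent_pair P (excursion_eta e) N) :
  same_distribution P (center_of_mass J)
    (fun w => Num.sqrt (excursion_eta e w) * N w).
Proof.
have e0 t w : 0 <= t <= 1 -> 0 <= e t w by exact: (excursion_ge0 he).
have ce w : {within `[0, 1], continuous (e ^~ w)} by exact: (excursion_continuous he).
set zeta := fun s w => 2 * e s w in hW hJ.
have mz t : 0 <= t <= 1 -> measurable_fun setT (zeta t).
  by move=> t01; apply: measurable_funM => //; exact: (excursion_measurable he).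
have cz w : {within `[0, 1], continuous (zeta ^~ w)}.
  move=> x; apply: (@continuousM R _ (cst 2) (e ^~ w : subspace `[0, 1] -> R)).
    exact: cvg_cst.
  exact: ce.
have z0 t w : 0 <= t <= 1 -> 0 <= zeta t w by move=> t01; rewrite mulr_ge0// e0.
have zs w : zeta 0 w = 0 by rewrite /zeta (excursion_start he) mulr0.
have Riem n := snake_head_riemann_gaussian mz (fun v => @cz v) z0 zs hW n.
pose UZ := g_sigma_algebraType (process_events `[0, 1] zeta).
have mid : measurable_fun setT (id : T -> UZ).
  apply: measurable_id_g_sigma => A [t /= + [B mB <-]]; rewrite in_itv/= setTI => t01.
  by apply: measurable_preimage => //; exact: mz.
pose S n w := \sum_(j < n.+1) n.+1%:R^-1 * snake_head zeta W (j%:R / n.+1%:R) w.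
pose Q n w := \sum_(i < n.+1) \sum_(j < n.+1) n.+1%:R^-1 * n.+1%:R^-1 *
  path_min zeta ((minn i j)%:R / n.+1%:R) ((maxn i j)%:R / n.+1%:R) w.
have cS w : S n w @[n --> \oo] --> center_of_mass J w.
  rewrite (integral_head_center_of_mass w hJ).
  by have [_ h] := riemann_sum_cvg (snake_head_continuous hW (w := w)).
have cEta w : Q n w @[n --> \oo] --> excursion_eta e w.
  exact: (@excursion_eta_riemann _ _ _ e w e0 (fun v => @ce v)).
have mEtaZ : measurable_fun setT (excursion_eta e : UZ -> R).
  apply: (@measurable_fun_cvg _ UZ _ setT Q) => [n|w _]; last exact: cEta.
  by have [_ mQ _] := Riem n.
have mEta : measurable_fun setT (excursion_eta e) by exact: (measurableT_comp mEtaZ mid).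
have mCM : measurable_fun setT (center_of_mass J).
  apply: (@measurable_fun_cvg _ _ _ setT S) => [n|w _]; last exact: cS.
  by have [mX _ _] := Riem n.
have cg : cond_gaussian P (id : T -> UZ) (center_of_mass J) (excursion_eta e).
  by apply: (@cond_gaussian_cvg _ _ T UZ _ _ _ mid S Q) => // n; have [] := Riem n.
have mN : measurable_fun setT N by exact: measurable_funPT.
apply: same_distribution_test => //.
  apply: measurable_funM => //; apply: measurableT_comp mEta; exact: measurable_sqrt.
move=> f cf f01.
have mf : measurable_fun setT f by exact: continuous_measurable_fun.
(* A kernel that ignores its first argument turns the conditional statement into one about the law
   of the center of mass. *)
have kf : test_kernel (fun (x : UZ) (y : R) => f y).
  split => //; exact: measurableT_comp.
rewrite (cg _ kf).
pose h (p : R * R) := (f (Num.sqrt p.1 * p.2))%:E.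
have mh : measurable_fun setT h.
  apply/measurable_EFinP; apply: measurableT_comp => //; apply: measurable_funM => //.
  by apply: measurableT_comp; [exact: measurable_sqrt|exact: measurable_fst].
have ind A B : measurable A -> measurable B ->
    (P (excursion_eta e @^-1` A `&` N @^-1` B) =
     P (excursion_eta e @^-1` A) * normal_prob 0 1 B)%E.
  by move=> mA mB; rewrite hind// hN.
have h0 p : (0 <= h p)%E by rewrite lee_fin; case/andP: (f01 (Num.sqrt p.1 * p.2)).
(* Independence of [N] from [excursion_eta e] lets the auxiliary Gaussian integral be replaced by
   evaluation at [N]. *)
by rewrite -[LHS](@integral_independent _ _ _ _ _ _ R P (normal_prob 0 1) _ _ h
  mEta mN ind mh h0).
Qed.
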